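(* Let $\mathbb H^d$ be the $d$-dimensional hyperbolic space realized as the hyperboloid model, with geodesic distance $d_{\mathbb H}$. Let $\kappa>0$ and let $\phi:[0,\infty)\to[0,\infty)$ be Lipschitz continuous with $$M:=\sup_{r\ge0}\big(r\coth(r)\,\phi(r)\big)<\infty,$$ where $r\coth r$ is understood as $1$ at $r=0$ by continuity. Let $\{(x_i(t),v_i(t))\}_{i=1}^N$ be a global solution on $\mathcal M=\mathbb H^d$ of the logarithmic velocity alignment system (defined in the context). Then the solution exhibits interaction-weighted asymptotic velocity alignment, that is, $$\lim_{t\to\infty}\max_{i,j\in[N]}\phi(d_{\mathbb H}(x_i(t),x_j(t)))\,\|P_{x_i(t)x_j(t)}v_j(t)-v_i(t)\|_{x_i(t)}=0.$$
   Context: Hyperboloid model: $\mathbb H^d:=\{x\in\mathbb R^{d+1}:\langle x,x\rangle_L=-1,\ x^0>0\}$ with $\langle x,y\rangle_L:=-x^0y^0+\sum_{\alpha=1}^dx^\alpha y^\alpha$; $T_x\mathbb H^d=\{v\in\mathbb R^{d+1}:\langle x,v\rangle_L=0\}$, and the Riemannian metric is the restriction of $\langle\cdot,\cdot\rangle_L$ to $T_x\mathbb H^d$ (constant sectional curvature $-1$). Notation: $[N]=\{1,\dots,N\}$; $\nabla$ is the Levi-Civita connection; $\|v\|_x=\sqrt{\langle v,v\rangle_L}$ for $v\in T_x\mathbb H^d$. For $x,y\in\mathbb H^d$, $\log_xy=\exp_x^{-1}(y)\in T_x\mathbb H^d$ is the initial velocity at $x$ of the unique length-minimizing geodesic on $[0,1]$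 from $x$ to $y$ (so $\log_xx=0$), and $P_{xy}:T_y\mathbb H^d\to T_x\mathbb H^d$ is parallel transport from $y$ to $x$ along the unique minimizing geodesic. Logarithmic velocity alignment system on $\mathcal M=\mathbb H^d$: for $i\in[N]$ and $t>0$, $$\dot x_i=v_i,\qquad \nabla_{v_i}v_i=\frac{\kappa}{N}\sum_{j=1}^N\phi(d_{\mathbb H}(x_i,x_j))\,\nabla_{v_i}\log_{x_i}x_j,\qquad (x_i(0),v_i(0))=(x_i^0,v_i^0)\in T\mathbb H^d,$$ where $\nabla_{v_i}v_i$ is the covariant derivative $\frac{D}{dt}v_i$ along the curve $x_i(t)$, and $\nabla_{v_i}\log_{x_i}x_j:=\frac{D}{dt}\log_{x_i(t)}x_j(t)$ is the covariant time derivative along $x_i(t)$ of the time-dependent vector $\log_{x_i(t)}x_j(t)$ (both endpoints moving). A global solution is a classical solution defined for all $t\ge0$ (each $x_i$ is $C^2$ and each $v_i$ is $C^1$ on $[0,\infty)$). *)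

(* Defs.v *)
From HB Require Import structures.
From mathcomp Require Import all_boot all_order all_algebra.
From mathcomp Require Import all_classical all_reals all_analysis.
Set Implicit Arguments.
Unset Strict Implicit.
Unset Printing Implicit Defensive.
Import Order.TTheory GRing.Theory Num.Theory.
Import numFieldNormedType.Exports.
Local Open Scope classical_set_scope.
Local Open Scope ring_scope.

Section Hyperboloid.
Context {R : realType}.

Definition coshR (r : R) : R := (expR r + expR (- r)) / 2.
Definition sinhR (r : R) : R := (expR r - expR (- r)) / 2.
Definition cothR (r : R) : R := coshR r / sinhR r.

Definition rcoth (r : R) : R := if r == 0 then 1 else r * cothR r.

(* Derivatives along a set I, so that they are one-sided at the endpoints of an
   interval and do not depend on the values of f outside I. *)
Definition diff_quot {V : normedModType R} (f : R -> V) (t s : R) : V :=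
  (s - t)^-1 *: (f s - f t).

Definition deriv_on {V : normedModType R} (I : set R) (f : R -> V) (t : R) : V :=
  lim (diff_quot f t s @[s --> within I t^']).

Definition C1_on {V : normedModType R} (I : set R) (f : R -> V) : Prop :=
  (forall t, I t -> cvg (diff_quot f t s @[s --> within I t^'])) /\
  {within I, continuous (deriv_on I f)}.

Definition C2_on {V : normedModType R} (I : set R) (f : R -> V) : Prop :=
  C1_on I f /\ C1_on I (deriv_on I f).

Definition unit_itv : set R := `[0, 1].
Definition half_line : set R := `[0, +oo[.

Context {d : nat}.
Local Notation E := 'rV[R]_d.+1.

Definition lorentz (x y : E) : R :=
  - (x 0 0 * y 0 0) + \sum_(a < d) x 0 (lift 0 a) * y 0 (lift 0 a).

Definition hyperboloid : set E := [set x | lorentz x x = -1 /\ 0 < x 0 0].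

Definition tangent (x : E) : set E := [set v | lorentz x v = 0].

Definition hnorm (v : E) : R := Num.sqrt (lorentz v v).

(* The Lorentz-orthogonal projection onto the tangent space at x; the sign
   comes from <x, x>_L = -1. *)
Definition tproj (x w : E) : E := w + lorentz x w *: x.

(* The covariant derivative along the curve c of a vector field V along c: the
   Levi-Civita connection of the metric induced by the flat Lorentz form is the
   tangential part of the ambient derivative. *)
Definition cov_deriv (I : set R) (c V : R -> E) (t : R) : E :=
  tproj (c t) (deriv_on I V t).

Definition curve_length (c : R -> E) : R :=
  (\int[lebesgue_measure]_(t in unit_itv) hnorm (deriv_on unit_itv c t))%R.

Definition joins (x y : E) (c : R -> E) : Prop :=
  [/\ C1_on unit_itv c, forall t, unit_itv t -> hyperboloid (c t),
      c 0 = x & c 1 = y].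

Definition hdist (x y : E) : R := inf [set curve_length c | c in joins x y].

Definition is_geodesic (c : R -> E) : Prop :=
  [/\ C2_on unit_itv c, forall t, unit_itv t -> hyperboloid (c t) &
      forall t, unit_itv t -> cov_deriv unit_itv c (deriv_on unit_itv c) t = 0].

Definition is_min_geodesic (x y : E) (c : R -> E) : Prop :=
  [/\ is_geodesic c, joins x y c & curve_length c = hdist x y].

(* xget picks the element of the given set, which is a singleton when x and y
   lie on the hyperboloid (and, for transport, when w is tangent at y). *)
Definition hlog (x y : E) : E :=
  xget 0 [set v | exists2 c, is_min_geodesic x y c & v = deriv_on unit_itv c 0].

Definition is_parallel (c W : R -> E) : Prop :=
  [/\ C1_on unit_itv W, forall t, unit_itv t -> tangent (c t) (W t) &
      forall t, unit_itv t -> cov_deriv unit_itv c W t = 0].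

(* transport x y goes from the tangent space at y to the tangent space at x. *)
Definition transport (x y w : E) : E :=
  xget 0 [set u | exists c W,
    [/\ is_min_geodesic y x c, is_parallel c W, W 0 = w & W 1 = u]].

Record is_global_solution (N : nat) (kappa : R) (phi : R -> R)
    (x0 v0 : 'I_N -> E) (x v : 'I_N -> R -> E) : Prop := IsGlobalSolution {
  sol_init : forall i,
    [/\ hyperboloid (x0 i), tangent (x0 i) (v0 i), x i 0 = x0 i & v i 0 = v0 i];
  sol_hyp : forall i t, 0 <= t -> hyperboloid (x i t);
  sol_tan : forall i t, 0 <= t -> tangent (x i t) (v i t);
  sol_C2 : forall i, C2_on half_line (x i);
  sol_C1 : forall i, C1_on half_line (v i);
  sol_pos : forall i t, 0 < t -> deriv_on half_line (x i) t = v i t;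
  sol_vel : forall i t, 0 < t ->
    cov_deriv half_line (x i) (v i) t =
    (kappa / N%:R) *: \sum_(j < N) phi (hdist (x i t) (x j t)) *:
      cov_deriv half_line (x i) (fun s => hlog (x i s) (x j s)) t }.

End Hyperboloid.

(* Main.v *)
Require Import Defs.
From HB Require Import structures.
From mathcomp Require Import all_boot all_order all_algebra.
From mathcomp Require Import all_classical all_reals all_analysis.
From mathcomp Require Import ring lra.
Import Order.TTheory GRing.Theory Num.Theory.
Import numFieldNormedType.Exports.
Local Open Scope classical_set_scope.
Local Open Scope ring_scope.

Set Implicit Arguments.
Unset Strict Implicit.
Unset Printing Implicit Defensive.

(** The kinetic energy F = sum_i |v_i|^2 is dissipated at a rate that controls
every pair.  Write a = v_i, b = v_j at the points x = x_i, y = x_j, let T be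
the parallel transport of b to x, and r = d(x, y).  Both a and T split along
the geodesic from x to y and orthogonally to it.  The covariant derivative of
log_x y has the same radial part as T - a, and the orthogonal part
(r / sinh r) T - (r coth r) a.  Adding to <a, D log_x y> the same pairing with
the two particles exchanged gives minus a quadratic form in (a, T) which is
|T - a|^2 on the radial part, and
(r coth r) (|a|^2 + |T|^2) - 2 (r / sinh r) <a, T> on the orthogonal part.  The
latter has eigenvalues r coth r + r / sinh r = r coth (r/2) >= 2 along a - T
and r coth r - r / sinh r >= 0 along a + T, so it dominates |T - a|^2
([dissipation]).  After symmetrizing the double sum,
F' <= - (kappa / N) sum_(i, j) phi(r_ij) |T - a|^2  ([power_le]).

It remains to see that each phi(r_ij) |T - a|^2 tends to 0.  F is nonnegative
and nonincreasing, so it cannot keep losing a definite amount, and a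
nonnegative Lipschitz function that bounds the rate of loss from below must
vanish at infinity ([lipschitz_dissipation_cvg0]).  The Lipschitz
bound ([weighted_gap_cvg0]) rests on three facts: speeds are bounded by the
energy; accelerations are bounded because
|D log_x y| <= 2 (r coth r) (|a| + |b|), whose product with phi is at most
2 M (|a| + |b|); and the derivative of <a, T> is the sum of two terms with
accelerations and of a curvature term, cubic in the speeds, whose coefficient
sinh r / (1 + cosh r) = tanh (r/2) stays below 1.  Since phi <= M, the estimate
(phi |T - a|)^2 <= M phi |T - a|^2 concludes.

All of this is computed in the ambient linear space, where cosh r = - <x, y>_L.
What makes this possible is that the three geometric notions, which are given
by an infimum of lengths and by solutions of differential equations, have
closed forms ([hdist_arcosh], [hlogE], [transportE]): d(x, y) = arcosh u,
log_x y = (r / sinh r) (y - u x) and T = b + <x, b>_L / (1 + u) (x + y), with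
u = - <x, y>_L.  A geodesic solves the linear equation c'' = l^2 c with
constant speed l, a field W parallel along it satisfies W' = k c with k
constant, and no curve is shorter than the distance because along a curve c
starting at x the function arcosh (- <x, c>_L) grows at most at speed |c'|
([arcosh_le_primitive]). *)

(** * Derivatives along an interval *)

Section Derivatives.
Context {R : realType}.

Lemma cvg_shift_dnbhs (T : Type) (g : R -> T) (t : R) :
  g \o shift t @ 0^' = g @ t^'.
Proof.
rewrite predeqE => A.
rewrite /nbhs /= /dnbhs /within /= !near_simpl (near_shift 0 t).
split; apply: filterS => h /= H.
  by rewrite subr0 => ht; apply: H; apply: contra_neq ht => ->; rewrite add0r.
move=> h0; have := H; rewrite subr0; apply.
by rewrite -subr_eq0 addrK.
Qed.

Lemma is_derive_diff_quot (V : normedModType R) (f : R -> V) (t : R) (l : V) :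
  is_derive t 1 f l <-> diff_quot f t s @[s --> t^'] --> l.
Proof.
have E : (fun h : R => h^-1 *: ((f \o shift t) (h *: (1 : R)) - f t)) @ 0^' =
         diff_quot f t @ t^'.
  rewrite -cvg_shift_dnbhs.
  suff -> : (fun h : R => h^-1 *: ((f \o shift t) (h *: (1 : R)) - f t)) =
            diff_quot f t \o shift t by [].
  by apply/funext => h /=; rewrite /diff_quot addrK [h%:A]mulr1.
split=> [[dv <-]|H].
  by move: dv; rewrite /derive /derivable E.
have dv : derivable f t 1 by rewrite /derivable E; exact: (cvgP l).
apply: DeriveDef => //; rewrite /derive E; exact: (cvg_lim (@norm_hausdorff _ _) H).
Qed.

Lemma within_absorb (T : Type) (F : set_system T) (A : set T) :
  Filter F -> F A -> within A F = F.
Proof.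
move=> FF FA; rewrite eqEsubset; split=> B; last by apply: filterS.
by move=> H; apply: filterS2 FA H => x ? ; apply.
Qed.

Lemma deriv_on_interior (V : normedModType R) (I : set R) (f : R -> V) t :
  nbhs t I -> cvg (diff_quot f t s @[s --> within I t^']) ->
  is_derive t 1 f (deriv_on I f t).
Proof.
move=> It; rewrite /deriv_on within_absorb; last exact: nbhs_dnbhs.
by move=> cf; apply/is_derive_diff_quot.
Qed.

Lemma is_derive_deriv_on (V : normedModType R) (I : set R) (f : R -> V) t l :
  ProperFilter (within I t^') -> is_derive t 1 f l ->
  cvg (diff_quot f t s @[s --> within I t^']) /\ deriv_on I f t = l.
Proof.
move=> PF /is_derive_diff_quot H.
have {}H : diff_quot f t s @[s --> within I t^'] --> l.
  by apply: cvg_trans H; apply: cvg_app; exact: cvg_within.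
by split; [exact: (cvgP l)|exact: (cvg_lim (@norm_hausdorff _ _) H)].
Qed.

(** The product (s - t) * diff_quot f t s tends to 0 because its second factor
converges; it is f s - f t away from t. *)
Lemma diff_quot_continuous (V : normedModType R) (I : set R) (f : R -> V) t :
  cvg (diff_quot f t s @[s --> within I t^']) ->
  f s @[s --> within I (nbhs t)] --> f t.
Proof.
move=> /cvg_ex[l H].
have H1 : (fun s => f t + (s - t) *: diff_quot f t s) @ within I t^' --> f t.
  rewrite -[X in _ --> X]addr0 -[X in _ --> _ + X](scale0r l).
  apply: cvgD; first exact: cvg_cst.
  apply: cvgZ => //; rewrite -[X in _ --> X](subrr t).
  apply: cvgB; last exact: cvg_cst.
  by apply: (cvg_trans (cvg_within _)); exact: nbhs_dnbhs.
move=> A At.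
have H2 : nbhs t [set s | s != t -> I s ->
    A (f t + (s - t) *: diff_quot f t s)] := H1 A At.
suff : nbhs t [set s | I s -> A (f s)] by [].
apply: filterS H2 => s /= + Is.
have [-> _|st] := eqVneq s t; first exact: nbhs_singleton.
move=> /(_ isT Is); rewrite /diff_quot scalerA divff ?subr_eq0// scale1r.
by rewrite addrC subrK.
Qed.

Lemma C1_on_continuous (V : normedModType R) (I : set R) (f : R -> V) :
  C1_on I f -> {within I, continuous f}.
Proof.
move=> [H _]; apply/subspace_continuousP => t It.
by apply: diff_quot_continuous; exact: H.
Qed.

(** Without this, one-sided limits at the ends of the interval would not be
unique and derivatives there would be meaningless. *)
Lemma unit_itv_proper (t : R) : unit_itv t -> ProperFilter (within unit_itv t^').
Proof.
rewrite /unit_itv/= in_itv/= => /andP[t0 t1].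
apply: Build_ProperFilter_ex => A.
move=> WA.
have {WA} : nbhs t [set s | s != t -> unit_itv s -> A s] := WA.
move=> /nbhs_ballP[e /= e0 H].
pose h := Num.min (e / 2) (1 / 2).
have h0 : 0 < h by rewrite lt_min; apply/andP; split; lra.
have he : h < e by rewrite gt_min; apply/orP; left; lra.
have h2 : h <= 1 / 2 by rewrite ge_min lexx orbT.
have [t2|t2] := leP t (1 / 2).
  exists (t + h); apply: H.
  - by rewrite /ball/= opprD addrA subrr add0r normrN gtr0_norm.
  - by rewrite gt_eqF// ltrDl.
  - by rewrite /unit_itv/= in_itv/=; apply/andP; split; lra.
exists (t - h); apply: H.
- by rewrite /ball/= opprB addrC subrK gtr0_norm.
- by rewrite lt_eqF// ltrBlDl ltrDr.
- by rewrite /unit_itv/= in_itv/=; apply/andP; split; lra.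
Qed.

Lemma unit_itv_interior (t : R) : t \in `]0, 1[ -> nbhs t (@unit_itv R).
Proof.
move=> t01; have := near_in_itvoo t01; apply: filterS => s.
exact: subset_itv_oo_cc.
Qed.

Lemma half_line_interior (t : R) : 0 < t -> nbhs t (@half_line R).
Proof.
move=> t0; have := lt_nbhsr t0; apply: filterS => s /= s0.
by rewrite /half_line/= in_itv/= andbT ltW.
Qed.

(** Explicit curves are differentiated on the whole line and then restricted,
which gives the one-sided derivatives at the ends for free. *)
Lemma smooth_C1_on (V : normedModType R) (f f' : R -> V) :
  (forall t : R, is_derive t 1 f (f' t)) -> continuous f' ->
  C1_on unit_itv f /\ {in unit_itv, deriv_on unit_itv f =1 f'}.
Proof.
move=> df cf'.
have E : {in unit_itv, deriv_on unit_itv f =1 f'}.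
  move=> t /set_mem It; have PF := unit_itv_proper It.
  by have [_ ->] := is_derive_deriv_on PF (df t).
split=> //; split=> [t It|].
  have PF := unit_itv_proper It.
  by have [] := is_derive_deriv_on PF (df t).
apply: subspace_eq_continuous (continuous_subspaceT cf').
by move=> t It; exact/esym/E.
Qed.

Lemma diff_quot_ext (V : normedModType R) (I : set R) (f g : R -> V) (t : R) :
  {in I, f =1 g} -> I t ->
  diff_quot f t @ within I t^' `=>` diff_quot g t @ within I t^'.
Proof.
move=> fg It A Ag.
suff : t^' [set s | I s -> A (diff_quot f t s)] by [].
have : t^' [set s | I s -> A (diff_quot g t s)] by [].
by apply: filterS => s + Is; rewrite /= /diff_quot !fg ?inE//; exact.
Qed.

Lemma deriv_on_ext (V : normedModType R) (I : set R) (f g : R -> V) (t : R) :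
  {in I, f =1 g} -> I t -> deriv_on I f t = deriv_on I g t.
Proof.
move=> fg It; rewrite /deriv_on; congr (lim _); apply/seteqP.
by split; apply: diff_quot_ext => // s Is; rewrite fg.
Qed.

Lemma C1_on_ext (V : normedModType R) (I : set R) (f g : R -> V) :
  {in I, f =1 g} -> C1_on I f -> C1_on I g.
Proof.
move=> fg [df cf]; split=> [t It|].
  have /cvg_ex[l fl] := df t It; apply: (cvgP l); apply: cvg_trans fl.
  by apply: diff_quot_ext => // s Is; rewrite fg.
apply: subspace_eq_continuous cf => t /set_mem It; exact: deriv_on_ext.
Qed.

Lemma is_derive_unique (V : normedModType R) (f : R -> V) (t : R) (l m : V) :
  is_derive t 1 f l -> is_derive t 1 f m -> l = m.
Proof. by move=> [_ <-] [_ <-]. Qed.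

Lemma unit_itv0 : unit_itv (0 : R).
Proof. by rewrite /unit_itv/= in_itv/= lexx ler01. Qed.

Lemma unit_itv1 : unit_itv (1 : R).
Proof. by rewrite /unit_itv/= in_itv/= lexx ler01. Qed.

Lemma unit_itv_oo (t : R) : t \in `]0, 1[ -> unit_itv t.
Proof. exact: subset_itv_oo_cc. Qed.

Lemma within_unit_continuous (f : R -> R) (t : R) : {within unit_itv, continuous f} ->
  t \in `]0, 1[ -> {for t, continuous f}.
Proof. by move=> /(continuous_within_itvP _ (@ltr01 R))[H _ _] /H. Qed.

Lemma is_derive_continuous (V : normedModType R) (f f' : R -> V) :
  (forall t : R, is_derive t 1 f (f' t)) -> continuous f.
Proof.
move=> df t; apply: differentiable_continuous; apply/derivable1_diffP.
by have [] := df t.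
Qed.


Lemma C1_unit_derive (V : normedModType R) (f : R -> V) (t : R) : C1_on unit_itv f ->
  t \in `]0, 1[ -> is_derive t 1 f (deriv_on unit_itv f t).
Proof.
move=> [cf _] t01; apply: deriv_on_interior; first exact: unit_itv_interior.
by apply: cf; exact: subset_itv_oo_cc.
Qed.

End Derivatives.

(** * The Lorentz form on the hyperboloid *)

Section Lorentz.
Context {R : realType} {d : nat}.
Local Notation E := 'rV[R]_d.+1.
Implicit Types x y z v w : E.

Lemma lorentzC x y : lorentz x y = lorentz y x.
Proof.
rewrite /lorentz mulrC; congr (_ + _).
by apply: eq_bigr => a _; rewrite mulrC.
Qed.

Lemma lorentzDl x y z : lorentz (x + y) z = lorentz x z + lorentz y z.
Proof.
rewrite /lorentz !mxE mulrDl opprD addrACA -big_split/=; congr (_ + _).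
by apply: eq_bigr => a _; rewrite !mxE mulrDl.
Qed.

Lemma lorentzZl (k : R) x y : lorentz (k *: x) y = k * lorentz x y.
Proof.
rewrite /lorentz !mxE mulrDr mulrN mulrA mulr_sumr; congr (_ + _).
by apply: eq_bigr => a _; rewrite !mxE mulrA.
Qed.

Lemma lorentzDr x y z : lorentz x (y + z) = lorentz x y + lorentz x z.
Proof. by rewrite lorentzC lorentzDl !(lorentzC x). Qed.

Lemma lorentzZr (k : R) x y : lorentz x (k *: y) = k * lorentz x y.
Proof. by rewrite lorentzC lorentzZl (lorentzC x). Qed.

Lemma lorentzNl x y : lorentz (- x) y = - lorentz x y.
Proof. by rewrite -scaleN1r lorentzZl mulN1r. Qed.

Lemma lorentzNr x y : lorentz x (- y) = - lorentz x y.
Proof. by rewrite lorentzC lorentzNl lorentzC. Qed.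

Lemma lorentz0l x : lorentz 0 x = 0.
Proof. by rewrite -(scale0r x) lorentzZl mul0r. Qed.

Lemma lorentz0r x : lorentz x 0 = 0.
Proof. by rewrite lorentzC lorentz0l. Qed.

Lemma lorentz_sumr x n (f : 'I_n -> E) :
  lorentz x (\sum_(i < n) f i) = \sum_(i < n) lorentz x (f i).
Proof.
elim/big_ind2 : _ => [|u u' w w' <- <-|//]; first exact: lorentz0r.
by rewrite lorentzDr.
Qed.

Definition lorentzE := (lorentzDl, lorentzDr, lorentzZl, lorentzZr,
  lorentzNl, lorentzNr, lorentz0l, lorentz0r).

(** One discriminant argument serves for the Euclidean Cauchy-Schwarz inequality
of the spatial parts and for that of the Lorentz form on a tangent space. *)
Lemma discriminant_le (A B C : R) :
  (forall a b : R, 0 <= a ^+ 2 * A + 2 * (a * b) * B + b ^+ 2 * C) ->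
  B ^+ 2 <= A * C.
Proof.
move=> H; have A0 : 0 <= A by have := H 1 0; lra.
have C0 : 0 <= C by have := H 0 1; lra.
have [C1|C1] := eqVneq C 0.
  suff -> : B = 0 by rewrite expr0n mulr_ge0.
  apply/eqP/negP => /negP B0; have := H 1 (- (A + 1) / (2 * B)).
  suff -> : 1 ^+ 2 * A + 2 * (1 * (- (A + 1) / (2 * B))) * B +
      (- (A + 1) / (2 * B)) ^+ 2 * C = -1 by lra.
  by rewrite C1; field.
have Cp : 0 < C by rewrite lt_def C1.
rewrite -subr_ge0 -(pmulr_rge0 _ Cp).
by have := H C (- B); congr (_ <= _); ring.
Qed.

Definition space_dot x y : R := \sum_(a < d) x 0 (lift 0 a) * y 0 (lift 0 a).

Lemma space_dot_CS x y :
  space_dot x y ^+ 2 <= space_dot x x * space_dot y y.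
Proof.
apply: discriminant_le => a b.
suff -> : a ^+ 2 * space_dot x x + 2 * (a * b) * space_dot x y +
   b ^+ 2 * space_dot y y = 
   \sum_(k < d) (a * x 0 (lift 0 k) + b * y 0 (lift 0 k)) ^+ 2.
  by apply: sumr_ge0 => k _; exact: sqr_ge0.
rewrite /space_dot !mulr_sumr -!big_split/=; apply: eq_bigr => k _; ring.
Qed.

Lemma hyperboloid_dot x : hyperboloid x -> space_dot x x = x 0 0 ^+ 2 - 1.
Proof. by move=> [+ _]; rewrite /lorentz -/(space_dot x x); lra. Qed.

(** If v is tangent at x then x^0 v^0 is the spatial product of x and v, and
Cauchy-Schwarz together with (x^0)^2 = 1 + |x|^2 shows that the time component
of v is too small to make its square negative. *)
Lemma tangent_ge0 x v : hyperboloid x -> tangent x v -> 0 <= lorentz v v.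
Proof.
move=> hx; rewrite /tangent/= {1}/lorentz -/(space_dot x v) => tv.
have CS := space_dot_CS x v; rewrite (hyperboloid_dot hx) in CS.
have x0 : 0 < x 0 0 ^+ 2 by rewrite exprn_gt0//; case: hx.
have v0 : 0 <= space_dot v v by apply: sumr_ge0 => k _; exact: sqr_ge0.
rewrite /lorentz -/(space_dot v v) -(pmulr_rge0 _ x0).
have E1 : space_dot x v = x 0 0 * v 0 0 by lra.
by rewrite E1 in CS; nra.
Qed.

Lemma tangent_eq0 x v : hyperboloid x -> tangent x v -> lorentz v v = 0 ->
  v = 0.
Proof.
move=> hx; rewrite /tangent/= {1}/lorentz -/(space_dot x v) => tv.
have CS := space_dot_CS x v; rewrite (hyperboloid_dot hx) in CS.
have x0 : 0 < x 0 0 by case: hx.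
rewrite /lorentz -/(space_dot v v) => v0.
have E1 : space_dot x v = x 0 0 * v 0 0 by lra.
have vE : v 0 0 * v 0 0 = space_dot v v by lra.
have S0 : space_dot v v <= 0 by rewrite E1 in CS; nra.
have vv0 : v 0 0 = 0.
  by apply/eqP; rewrite -sqrf_eq0 expr2 vE eq_le S0 -vE -expr2 sqr_ge0.
have/eqP := vE; rewrite vv0 mul0r eq_sym psumr_eq0; last first.
  by move=> k _; exact: sqr_ge0.
move=> /allP H; apply/rowP => k; rewrite [RHS]mxE.
have [j ->|->] := unliftP 0 k; last by [].
have := H j (mem_index_enum _); rewrite /= mulf_eq0 orbb.
by move/eqP.
Qed.

Lemma tangentD x v w : tangent x v -> tangent x w -> tangent x (v + w).
Proof. by rewrite /tangent/= lorentzDr => -> ->; rewrite addr0. Qed.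

Lemma tangentZ x (k : R) v : tangent x v -> tangent x (k *: v).
Proof. by rewrite /tangent/= lorentzZr => ->; rewrite mulr0. Qed.

Lemma tangentN x v : tangent x v -> tangent x (- v).
Proof. by rewrite /tangent/= lorentzNr => ->; rewrite oppr0. Qed.

Lemma tangentB x v w : tangent x v -> tangent x w -> tangent x (v - w).
Proof. by move=> tv tw; apply: tangentD => //; exact: tangentN. Qed.

Lemma tangent_tproj x w : hyperboloid x -> tangent x (tproj x w).
Proof.
by move=> [hx _]; rewrite /tangent/= /tproj lorentzDr lorentzZr hx mulrN1 subrr.
Qed.

Lemma hnorm_ge0 v : 0 <= hnorm v.
Proof. exact: sqrtr_ge0. Qed.

Lemma hnorm_sqr x v : hyperboloid x -> tangent x v ->
  hnorm v ^+ 2 = lorentz v v.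
Proof. by move=> hx tv; rewrite /hnorm sqr_sqrtr// (tangent_ge0 hx). Qed.

Lemma hnormN v : hnorm (- v) = hnorm v.
Proof. by rewrite /hnorm lorentzNl lorentzNr opprK. Qed.

Lemma hnormZ (k : R) v : hnorm (k *: v) = `|k| * hnorm v.
Proof.
by rewrite /hnorm lorentzZl lorentzZr mulrA -expr2 sqrtrM ?sqr_ge0// sqrtr_sqr.
Qed.

Lemma hnorm0 : hnorm (0 : E) = 0.
Proof. by rewrite /hnorm lorentz0l sqrtr0. Qed.

Lemma tangent_CS x v w : hyperboloid x -> tangent x v -> tangent x w ->
  `|lorentz v w| <= hnorm v * hnorm w.
Proof.
move=> hx tv tw.
rewrite -ler_sqr ?nnegrE ?mulr_ge0 ?hnorm_ge0// real_normK ?num_real//.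
rewrite exprMn (hnorm_sqr hx tv) (hnorm_sqr hx tw).
apply: discriminant_le => a b.
have := tangent_ge0 hx (tangentD (tangentZ a tv) (tangentZ b tw)).
rewrite !lorentzE (lorentzC w v); congr (_ <= _); ring.
Qed.

Lemma hnormD x v w : hyperboloid x -> tangent x v -> tangent x w ->
  hnorm (v + w) <= hnorm v + hnorm w.
Proof.
move=> hx tv tw.
rewrite -ler_sqr ?nnegrE ?addr_ge0 ?hnorm_ge0// (hnorm_sqr hx (tangentD tv tw)).
rewrite sqrrD (hnorm_sqr hx tv) (hnorm_sqr hx tw) !lorentzE (lorentzC w v).
have := tangent_CS hx tv tw; have := ler_norm (lorentz v w); lra.
Qed.

Lemma hnorm_sum x n (f : 'I_n -> E) : hyperboloid x ->
  (forall i, tangent x (f i)) ->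
  hnorm (\sum_(i < n) f i) <= \sum_(i < n) hnorm (f i).
Proof.
move=> hx tf.
suff [] : tangent x (\sum_(i < n) f i) /\
    hnorm (\sum_(i < n) f i) <= \sum_(i < n) hnorm (f i) by [].
elim/big_ind2 : _ => [|u a w b [tu ua] [tw wb]|i _].
- by rewrite hnorm0 /tangent/= lorentz0r.
- split; first exact: tangentD.
  by apply: le_trans (hnormD hx tu tw) _; exact: lerD.
- by split.
Qed.

(** The two sheets of <z, z>_L = -1 are separated by the sign of the product
with a point of the upper one: the time components dominate by
Cauchy-Schwarz. *)
Lemma lorentz_lt0_sheet x z : hyperboloid x -> lorentz z z = -1 ->
  (0 < z 0 0) = (lorentz x z < 0).
Proof.
move=> hx hz.
have CS := space_dot_CS x z; rewrite (hyperboloid_dot hx) in CS.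
have zz : space_dot z z = z 0 0 ^+ 2 - 1.
  by move: hz; rewrite /lorentz -/(space_dot z z); lra.
rewrite zz in CS.
have x0 : 0 < x 0 0 by case: hx.
rewrite /lorentz -/(space_dot x z).
have H (a b s : R) : 0 < a -> s ^+ 2 <= (a ^+ 2 - 1) * (b ^+ 2 - 1) ->
    0 <= b ^+ 2 - 1 -> 0 <= b -> - (a * b) + s < 0.
  move=> a0 le_s b1 b0; rewrite ltNge; apply/negP => abs.
  have : (a * b) ^+ 2 <= s ^+ 2.
    have ab0 : 0 <= a * b by rewrite mulr_ge0// ltW.
    by rewrite ler_sqr ?nnegrE//; lra.
  have : 0 < a ^+ 2 by rewrite exprn_gt0.
  by nra.
have z1 : 0 <= z 0 0 ^+ 2 - 1.
  by rewrite -zz; apply: sumr_ge0 => k _; exact: sqr_ge0.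
apply/idP/idP => [z0|].
  by apply: H => //; exact: ltW.
move=> neg; rewrite ltNge; apply/negP => z0.
have := H (x 0 0) (- z 0 0) (- space_dot x z).
by rewrite !sqrrN => /(_ x0 CS z1); lra.
Qed.

(** The tangential part of y at x has square <x, y>^2 - 1, which is therefore
nonnegative. *)
Lemma lorentz_cosh_ge1 x y : hyperboloid x -> hyperboloid y -> 1 <= - lorentz x y.
Proof.
move=> hx hy; have neg : lorentz x y < 0.
  by rewrite -(lorentz_lt0_sheet hx); case: hy.
have := tangent_ge0 hx (tangent_tproj y hx).
rewrite /tproj !lorentzE (lorentzC y x); case: hx => -> _; case: hy => -> _.
by nra.
Qed.

Lemma lorentz_eqN1 x y : hyperboloid x -> hyperboloid y ->
  - lorentz x y = 1 -> x = y.
Proof.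
move=> hx hy xy; have xy1 : lorentz x y = -1 by rewrite -xy opprK.
have : tproj x y = 0.
  apply: (tangent_eq0 hx (tangent_tproj y hx)).
  rewrite /tproj !lorentzE (lorentzC y x) xy1.
  by case: hx => -> _; case: hy => -> _; lra.
by rewrite /tproj xy1 scaleN1r => /eqP; rewrite subr_eq0 => /eqP.
Qed.

(** Only the tangential part of y at x, of length sqrt (<x, y>^2 - 1), that is,
sinh of the distance, is seen by v. *)
Lemma tangent_pairing x y v : hyperboloid x -> hyperboloid y -> tangent x v ->
  `|lorentz y v| <= Num.sqrt (lorentz x y ^+ 2 - 1) * hnorm v.
Proof.
move=> hx hy tv; have := tangent_CS hx (tangent_tproj y hx) tv.
have -> : lorentz (tproj x y) v = lorentz y v.
  by rewrite /tproj lorentzDl lorentzZl tv mulr0 addr0.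
suff -> : hnorm (tproj x y) = Num.sqrt (lorentz x y ^+ 2 - 1) by [].
rewrite /hnorm; congr Num.sqrt; rewrite /tproj !lorentzE (lorentzC y x).
by case: hx => -> _; case: hy => -> _; ring.
Qed.

End Lorentz.

(** * Differentiating vectors and products *)

Section VectorDerivatives.
Context {R : realType} {d : nat}.
Local Notation E := 'rV[R]_d.+1.

Lemma is_derive_mul (f g : R -> R) (t l m : R) :
  is_derive t 1 f l -> is_derive t 1 g m ->
  is_derive t 1 (fun s => f s * g s) (l * g t + f t * m).
Proof.
move=> df dg; apply: is_derive_eq (is_deriveM df dg) _.
by rewrite addrC; congr (_ + _); exact: mulrC.
Qed.

Lemma is_derive_rowP (f : R -> E) (t : R) (l : E) :
  is_derive t 1 f l <-> forall k, is_derive t 1 (fun s => f s 0 k) (l 0 k).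
Proof.
split=> [[df <-] k|H].
  have dk : derivable (fun s => f s 0 k) t 1.
    by have /derivable_mxP := df; apply.
  by apply: DeriveDef => //; rewrite derive_mx// mxE.
have df : derivable f t 1.
  by apply/derivable_mxP => i k; rewrite (ord1 i); have [] := H k.
apply: DeriveDef => //; rewrite derive_mx//; apply/rowP => k; rewrite mxE.
by have [_ ->] := H k.
Qed.

Lemma is_derive_lorentz (f g : R -> E) (t : R) (l m : E) :
  is_derive t 1 f l -> is_derive t 1 g m ->
  is_derive t 1 (fun s => lorentz (f s) (g s))
    (lorentz l (g t) + lorentz (f t) m).
Proof.
move=> /is_derive_rowP df /is_derive_rowP dg.
have dM k : is_derive t 1 (fun s => f s 0 k * g s 0 k)
    (l 0 k * g t 0 k + f t 0 k * m 0 k).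
  exact: is_derive_mul.
have -> : (fun s => lorentz (f s) (g s)) =
   - (fun s => f s 0 0 * g s 0 0) +
   \sum_(a < d) (fun s => f s 0 (lift 0 a) * g s 0 (lift 0 a)).
  by apply/funext => s; rewrite /lorentz !fctE/= fct_sumE.
have H := is_deriveD (is_deriveN (dM 0)) (is_derive_sum (fun a => dM (lift 0 a))).
apply: is_derive_eq H _.
by rewrite /lorentz addrACA -opprD -big_split/=.
Qed.

Lemma is_derive_scale (k : R -> R) (f : R -> E) (t k' : R) (l : E) :
  is_derive t 1 k k' -> is_derive t 1 f l ->
  is_derive t 1 (fun s => k s *: f s) (k' *: f t + k t *: l).
Proof.
move=> dk /is_derive_rowP df; apply/is_derive_rowP => j.
have -> : (fun s => (k s *: f s) 0 j) = (fun s => k s * f s 0 j).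
  by apply/funext => s; rewrite mxE.
by rewrite !mxE; exact: is_derive_mul.
Qed.

Lemma cvg_coord (T : Type) (F : set_system T) (FF : Filter F)
    (h : T -> E) (c : E) k :
  h @ F --> c -> (fun s => h s 0 k) @ F --> c 0 k.
Proof.
by move=> hc; apply: (continuous_cvg _ (@coord_continuous _ _ _ 0 k c)) hc.
Qed.

Lemma cvg_lorentz (T : Type) (F : set_system T) (FF : Filter F)
    (f g : T -> E) (a b : E) :
  f @ F --> a -> g @ F --> b ->
  (fun s => lorentz (f s) (g s)) @ F --> lorentz a b.
Proof.
move=> fa gb.
rewrite /lorentz; apply: cvgD.
  by apply: cvgN; apply: cvgM; exact: cvg_coord.
by apply: cvg_big => [|k _]; [exact: add_continuous|apply: cvgM; exact: cvg_coord].
Qed.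

Lemma within_lorentz (A : set R) (f g : R -> E) :
  {within A, continuous f} -> {within A, continuous g} ->
  {within A, continuous (fun s => lorentz (f s) (g s))}.
Proof. by move=> cf cg t; apply: cvg_lorentz; [exact: cf|exact: cg]. Qed.

(** The conserved quantities of geodesics and of parallel fields are compared
between the two ends of the unit interval; there, continuity replaces the
differential equation. *)
Lemma constant_on_unit (f : R -> R) :
  {within unit_itv, continuous f} ->
  (forall t : R, t \in `]0, 1[ -> is_derive t 1 f 0) ->
  {in unit_itv, forall t, f t = f 0}.
Proof.
move=> cf df t /set_mem; rewrite /unit_itv/= in_itv/= => /andP[t0 t1].
have [c _] : exists2 c, c \in `[0, t] & f t - f 0 = 0 * (t - 0).
  apply: (@MVT_segment R f (fun=> 0)) => //.
    move=> s; rewrite in_itv/= => /andP[s0 s1]; apply: df.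
    by rewrite in_itv/= s0 (lt_le_trans s1).
  by apply: continuous_subspaceW cf; apply: subset_itvl; rewrite bnd_simp.
by rewrite mul0r => /eqP; rewrite subr_eq0 => /eqP.
Qed.

Lemma constant_row_on_unit (f : R -> E) :
  {within unit_itv, continuous f} ->
  (forall t : R, t \in `]0, 1[ -> is_derive t 1 f 0) ->
  {in unit_itv, forall t, f t = f 0}.
Proof.
move=> cf df t It; apply/rowP => k.
apply: (@constant_on_unit (fun s => f s 0 k)) => //.
  by move=> s; exact: cvg_coord (cf s).
by move=> s /df /is_derive_rowP /(_ k); rewrite mxE.
Qed.

End VectorDerivatives.

(** * Hyperbolic functions and arcosh *)

Section HyperbolicFunctions.
Context {R : realType}.
Implicit Types r t u : R.

Lemma coshR0 : coshR 0 = 1 :> R.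
Proof. by rewrite /coshR oppr0 expR0; lra. Qed.

Lemma sinhR0 : sinhR 0 = 0 :> R.
Proof. by rewrite /sinhR oppr0 subrr mul0r. Qed.

Lemma coshR_sqr r : coshR r ^+ 2 = 1 + sinhR r ^+ 2.
Proof.
rewrite /coshR /sinhR expRN; have := expR_gt0 r; move: (expR r) => e e0.
by field; rewrite gt_eqF.
Qed.

Lemma coshRDsinhR r : coshR r + sinhR r = expR r.
Proof. by rewrite /coshR /sinhR; field. Qed.

Lemma coshR_gt0 r : 0 < coshR r.
Proof. by rewrite /coshR divr_gt0// addr_gt0// expR_gt0. Qed.

Lemma coshR_ge1 r : 1 <= coshR r.
Proof. by have := coshR_gt0 r; have := coshR_sqr r; nra. Qed.

Lemma is_derive_coshR r : is_derive r 1 coshR (sinhR r).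
Proof.
have -> : coshR = (fun s => 2^-1 * (expR s + expR (- s))) :> (R -> R).
  by apply/funext => s; rewrite /coshR mulrC.
by apply: is_derive_eq; rewrite /sinhR /GRing.scale/=; ring.
Qed.

Lemma is_derive_sinhR r : is_derive r 1 sinhR (coshR r).
Proof.
have -> : sinhR = (fun s => 2^-1 * (expR s - expR (- s))) :> (R -> R).
  by apply/funext => s; rewrite /sinhR mulrC.
by apply: is_derive_eq; rewrite /coshR /GRing.scale/=; ring.
Qed.

Lemma is_derive_comp_scale (f : R -> R) (f' l t : R) :
  is_derive (l * t) 1 f f' -> is_derive t 1 (fun s => f (l * s)) (l * f').
Proof.
move=> df; rewrite mulrC; apply: (@is_derive1_comp _ f (fun s => l * s)) => //.
by apply: is_derive_eq; rewrite /GRing.scale/=; ring.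
Qed.

Lemma is_derive_cosh_scale l t :
  is_derive t 1 (fun s => coshR (l * s)) (l * sinhR (l * t)).
Proof. exact/is_derive_comp_scale/is_derive_coshR. Qed.

Lemma is_derive_sinh_scale l t :
  is_derive t 1 (fun s => sinhR (l * s)) (l * coshR (l * t)).
Proof. exact/is_derive_comp_scale/is_derive_sinhR. Qed.

Lemma sinhR_ge0 r : 0 <= r -> 0 <= sinhR r.
Proof.
move=> r0; rewrite /sinhR divr_ge0// subr_ge0 ler_expR; lra.
Qed.

Lemma coshR_le r s : 0 <= r -> r <= s -> coshR r <= coshR s.
Proof.
move=> r0 rs; rewrite /coshR ler_pM2r// !expRN.
have e1 : 1 <= expR r by rewrite -expR0 ler_expR.
have e2 : expR r <= expR s by rewrite ler_expR.
move: (expR r) (expR s) e1 e2 => a b a1 ab.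
have -> : b + b^-1 = a + a^-1 + (b - a) * (1 - (a * b)^-1).
  by field; apply/andP; split; rewrite gt_eqF//; lra.
rewrite lerDl mulr_ge0 ?subr_ge0// invf_le1; nra.
Qed.

(** By the mean value theorem sinh r = r cosh c with 0 <= c <= r, and cosh
increases from 1. *)
Lemma sinhR_bounds r : 0 <= r -> r <= sinhR r <= r * coshR r.
Proof.
move=> r0.
have [c /[!in_itv]/= /andP[c0 cr] E] : exists2 c, c \in `[0, r] &
    sinhR r - sinhR 0 = coshR c * (r - 0).
  apply: MVT_segment => // [x _|]; first exact: is_derive_sinhR.
  apply: derivable_within_continuous => x _.
  by have [] := is_derive_sinhR x.
have -> : sinhR r = coshR c * r by move: E; rewrite sinhR0 !subr0.
have := coshR_ge1 c; have := coshR_le c0 cr => *; apply/andP; split; nra.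
Qed.

Lemma sinhR_double r : sinhR (r + r) = 2 * sinhR r * coshR r.
Proof.
by rewrite /sinhR /coshR opprD !expRD; field.
Qed.

Lemma coshR_double r : coshR (r + r) + 1 = 2 * coshR r ^+ 2.
Proof.
rewrite /coshR opprD !expRD expRN; have := expR_gt0 r; move: (expR r) => e e0.
by field; rewrite gt_eqF.
Qed.

(** This is r coth (r/2) >= 2, freed of quotients: at half the argument it
becomes sinh <= r cosh. *)
Lemma sinhR_half r : 0 <= r -> 2 * sinhR r <= r * (coshR r + 1).
Proof.
move=> r0; have r20 : 0 <= r / 2 by lra.
have -> : r = r / 2 + r / 2 by field.
rewrite sinhR_double coshR_double.
have /andP[_] := sinhR_bounds r20; have := coshR_gt0 (r / 2).
move: (sinhR _) (coshR _) => s c c0 sc; nra.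
Qed.

Definition arcosh u : R := ln (u + Num.sqrt (u ^+ 2 - 1)).

Lemma expR_arcosh u : 1 <= u -> expR (arcosh u) = u + Num.sqrt (u ^+ 2 - 1).
Proof.
move=> u1; rewrite lnK// posrE ltr_pwDl ?sqrtr_ge0//; lra.
Qed.

Lemma expR_Narcosh u : 1 <= u -> expR (- arcosh u) = u - Num.sqrt (u ^+ 2 - 1).
Proof.
move=> u1; rewrite expRN expR_arcosh//.
have s2 : Num.sqrt (u ^+ 2 - 1) ^+ 2 = u ^+ 2 - 1 by rewrite sqr_sqrtr; nra.
have := sqrtr_ge0 (u ^+ 2 - 1); move: (Num.sqrt _) s2 => s s2 s0.
apply: (mulfI (_ : u + s != 0)); first by rewrite gt_eqF//; lra.
rewrite mulfV ?gt_eqF//; nra.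
Qed.

Lemma coshR_arcosh u : 1 <= u -> coshR (arcosh u) = u.
Proof. by move=> u1; rewrite /coshR expR_Narcosh// expR_arcosh//; field. Qed.

Lemma sinhR_arcosh u : 1 <= u -> sinhR (arcosh u) = Num.sqrt (u ^+ 2 - 1).
Proof. by move=> u1; rewrite /sinhR expR_Narcosh// expR_arcosh//; field. Qed.

Lemma sinhR_sqrt r : 0 <= r -> Num.sqrt (coshR r ^+ 2 - 1) = sinhR r.
Proof.
by move=> r0; rewrite coshR_sqr addrC addKr sqrtr_sqr ger0_norm// sinhR_ge0.
Qed.

Lemma arcosh_coshR r : 0 <= r -> arcosh (coshR r) = r.
Proof. by move=> r0; rewrite /arcosh sinhR_sqrt// coshRDsinhR expRK. Qed.

Lemma arcosh_ge0 u : 1 <= u -> 0 <= arcosh u.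
Proof.
move=> u1; rewrite /arcosh ln_ge0//; have := sqrtr_ge0 (u ^+ 2 - 1); lra.
Qed.

Lemma arcosh1 : arcosh 1 = 0.
Proof. by rewrite -{1}coshR0 arcosh_coshR. Qed.

Lemma is_derive_arcosh u : 1 < u ->
  is_derive u 1 arcosh (Num.sqrt (u ^+ 2 - 1))^-1.
Proof.
move=> u1; have s0 : 0 < u ^+ 2 - 1 by nra.
have S0 : 0 < Num.sqrt (u ^+ 2 - 1) by rewrite sqrtr_gt0.
have d2 : is_derive u 1 (fun x : R => x ^+ 2 - 1) (2 * u).
  by apply: is_derive_eq; rewrite /GRing.scale/=; ring.
have d3 : is_derive u 1 (Num.sqrt \o (fun x : R => x ^+ 2 - 1))
    ((2 * Num.sqrt (u ^+ 2 - 1))^-1 * (2 * u)).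
  by apply: is_derive1_comp; exact: is_derive1_sqrt.
have d4 : is_derive u 1 (fun x : R => x + Num.sqrt (x ^+ 2 - 1))
    (1 + (2 * Num.sqrt (u ^+ 2 - 1))^-1 * (2 * u)).
  exact: (is_deriveD (is_derive_id _ _) d3).
have d5 := is_derive1_ln (_ : 0 < u + Num.sqrt (u ^+ 2 - 1)).
have {}d5 := d5 (ltac:(lra)).
apply: is_derive_eq (@is_derive1_comp _ (@ln R)
  (fun x : R => x + Num.sqrt (x ^+ 2 - 1)) _ _ _ d5 d4) _.
move: (Num.sqrt _) S0 => S S0; field; rewrite !gt_eqF//; lra.
Qed.

Lemma continuous_arcosh u : 0 < u -> {for u, continuous arcosh}.
Proof.
move=> u0.
have cS : Num.sqrt (x ^+ 2 - 1) @[x --> u] --> Num.sqrt (u ^+ 2 - 1).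
  apply: continuous_cvg; first exact: sqrt_continuous.
  by apply: cvgB; [exact: exprn_continuous|exact: cvg_cst].
apply: continuous_cvg; last by apply: cvgD; [exact: cvg_id|exact: cS].
by apply: continuous_ln; have := sqrtr_ge0 (u ^+ 2 - 1); lra.
Qed.

(** The coefficient r / sinh r of the logarithm as a function of u = cosh r,
extended by continuity. *)
Definition arcosh_ratio u : R :=
  if u == 1 then 1 else arcosh u / Num.sqrt (u ^+ 2 - 1).

Lemma arcosh_ratio1 : arcosh_ratio 1 = 1.
Proof. by rewrite /arcosh_ratio eqxx. Qed.

Lemma sqrtr_sqrB1_gt0 u : 1 < u -> 0 < Num.sqrt (u ^+ 2 - 1).
Proof. by move=> u1; rewrite sqrtr_gt0; nra. Qed.

Lemma arcosh_ratio_le1 u : 1 <= u -> arcosh_ratio u <= 1.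
Proof.
move=> u1; rewrite /arcosh_ratio; case: eqVneq => // un1.
have S0 : 0 < Num.sqrt (u ^+ 2 - 1) by apply: sqrtr_sqrB1_gt0; rewrite lt_def un1.
rewrite ler_pdivrMr// mul1r -sinhR_arcosh//.
by have /andP[] := sinhR_bounds (arcosh_ge0 u1).
Qed.

Lemma arcosh_ratio_ge u : 1 <= u -> 2 <= arcosh_ratio u * (u + 1).
Proof.
move=> u1; rewrite /arcosh_ratio; case: eqVneq => [->|un1]; first lra.
have S0 : 0 < Num.sqrt (u ^+ 2 - 1) by apply: sqrtr_sqrB1_gt0; rewrite lt_def un1.
rewrite mulrAC ler_pdivlMr// -sinhR_arcosh//.
by have := sinhR_half (arcosh_ge0 u1); rewrite coshR_arcosh.
Qed.

Lemma arcosh_ratio_ge0 u : 1 <= u -> 0 <= arcosh_ratio u.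
Proof. by move=> u1; have := arcosh_ratio_ge u1; nra. Qed.

Lemma arcosh_ratioM_ge1 u : 1 <= u -> 1 <= u * arcosh_ratio u.
Proof.
move=> u1; have := arcosh_ratio_ge u1; have := arcosh_ratio_le1 u1.
by move: (arcosh_ratio u) => g; nra.
Qed.

Lemma rcoth_arcosh u : 1 <= u -> rcoth (arcosh u) = u * arcosh_ratio u.
Proof.
move=> u1; rewrite /rcoth /arcosh_ratio; have [->|un1] := eqVneq u 1.
  by rewrite arcosh1 eqxx mulr1.
case: eqP => [r0|_].
  by move: un1; rewrite -(coshR_arcosh u1) r0 coshR0 eqxx.
by rewrite /cothR coshR_arcosh// sinhR_arcosh// mulrCA.
Qed.

(** A squeeze between 2 / (u + 1) and 1. *)
Lemma arcosh_ratio_cvg1 (T : Type) (F : set_system T) (FF : Filter F)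
    (u : T -> R) : (\forall t \near F, 1 <= u t) ->
  u @ F --> (1 : R) -> (arcosh_ratio \o u) @ F --> (1 : R).
Proof.
move=> u1 cu.
have cl : (fun t : T => 2 / (u t + 1) : R) @ F --> (1 : R).
  rewrite [X in _ --> X](_ : (1 : R) = 2 / (1 + 1)); last by field.
  apply: cvgM; first exact: cvg_cst.
  apply: cvgV; first by rewrite gt_eqF.
  by apply: cvgD => //; exact: cvg_cst.
apply: (@squeeze_cvgr T F FF R _ (fun=> 1) (arcosh_ratio \o u) _ _ cl (@cvg_cst R^o 1 _ F _)).
near=> t; have ut1 : 1 <= u t by near: t.
rewrite /= arcosh_ratio_le1// andbT ler_pdivrMr ?arcosh_ratio_ge//; lra.
Unshelve. all: by end_near. Qed.

Lemma is_derive_arcosh_ratio u : 1 < u ->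
  is_derive u 1 arcosh_ratio ((1 - u * arcosh_ratio u) / (u ^+ 2 - 1)).
Proof.
move=> u1; have S0 := sqrtr_sqrB1_gt0 u1.
have d2 : is_derive u 1 (fun x : R => x ^+ 2 - 1) (2 * u).
  by apply: is_derive_eq; rewrite /GRing.scale/=; ring.
have d3 : is_derive u 1 (Num.sqrt \o (fun x : R => x ^+ 2 - 1))
    ((2 * Num.sqrt (u ^+ 2 - 1))^-1 * (2 * u)).
  by apply: is_derive1_comp; apply: is_derive1_sqrt; nra.
have d4 := is_deriveV (lt0r_neq0 S0 : (Num.sqrt \o _) u != 0) d3.
have d5 := is_derive_mul (is_derive_arcosh u1) d4.
have : is_derive u 1 arcosh_ratio
   ((Num.sqrt (u ^+ 2 - 1))^-1 / Num.sqrt (u ^+ 2 - 1) +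
     arcosh u * (- Num.sqrt (u ^+ 2 - 1) ^- 2 *
      ((2 * Num.sqrt (u ^+ 2 - 1))^-1 * (2 * u)))).
  apply: near_eq_is_derive d5; have := lt_nbhsr u1; apply: filterS => s s1.
  by rewrite /arcosh_ratio gt_eqF.
move=> d6; apply: is_derive_eq d6 _; rewrite /arcosh_ratio gt_eqF//.
have s2 : u ^+ 2 - 1 = Num.sqrt (u ^+ 2 - 1) ^+ 2 by rewrite sqr_sqrtr; nra.
rewrite [in RHS]s2 sqrtr_sqr ger0_norm; last exact: ltW.
by field; rewrite gt_eqF.
Qed.

(** The length estimate behind both the lower bound for the distance and its
Lipschitz dependence on the end points.  As arcosh is not differentiable at 1,
where the curves may start or collide, u is replaced by u + e: the derivative
of arcosh (u + e) is still at most g in absolute value, because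
u^2 <= (u + e)^2, and e tends to 0 at the end. *)
Lemma arcosh_le_primitive (a b : R) (u u' G g : R -> R) : a <= b ->
  {within `[a, b], continuous u} -> {within `[a, b], continuous G} ->
  (forall t, t \in `[a, b] -> 1 <= u t) ->
  (forall t, t \in `]a, b[ -> is_derive t 1 u (u' t)) ->
  (forall t, t \in `]a, b[ -> is_derive t 1 G (g t)) ->
  (forall t, t \in `]a, b[ -> 0 <= g t /\
     `|u' t| <= Num.sqrt (u t ^+ 2 - 1) * g t) ->
  `|arcosh (u b) - arcosh (u a)| <= G b - G a.
Proof.
rewrite le_eqVlt => /predU1P[<- _ _ _ _ _ _|ab cu cG u1 du dG le_u].
  by rewrite !subrr normr0.
have a_in : a \in `[a, b] by rewrite in_itv/= lexx ltW.
have b_in : b \in `[a, b] by rewrite in_itv/= lexx ltW.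
(* sg is 1 or -1, so that one computation bounds the difference on both sides *)
have perturbed (sg e : R) : `|sg| = 1 -> 0 < e ->
    0 <= (G b + sg * arcosh (u b + e)) - (G a + sg * arcosh (u a + e)).
  move=> sg1 e0.
  have ue t : t \in `[a, b] -> 1 < u t + e by move=> /u1; lra.
  have [c cab ->] : exists2 c, c \in `]a, b[ &
     (G b + sg * arcosh (u b + e)) - (G a + sg * arcosh (u a + e)) =
     (g c + sg * ((Num.sqrt ((u c + e) ^+ 2 - 1))^-1 * u' c)) * (b - a).
    apply: (@MVT R (fun t => G t + sg * arcosh (u t + e))
      (fun c => g c + sg * ((Num.sqrt ((u c + e) ^+ 2 - 1))^-1 * u' c)) _ _ ab).
      move=> t tab; have tab' : t \in `[a, b] by exact: subset_itv_oo_cc.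
      have d1 : is_derive t 1 (fun s => u s + e) (u' t).
        apply: is_derive_eq; first exact: is_deriveD (du _ tab) (is_derive_cst _ _ _).
        by rewrite addr0.
      have d2 := @is_derive1_comp _ arcosh (fun s => u s + e) _ _ _
        (is_derive_arcosh (ue _ tab')) d1.
      exact: is_deriveD (dG _ tab) (is_deriveZ sg d2).
    apply/subspace_continuousP => t tab; have {}tab' : t \in `[a, b] by [].
    apply: cvgD; first by move/subspace_continuousP : cG; exact.
    apply: cvgM; first exact: cvg_cst.
    apply: (@continuous_cvg _ _ _ _ _ _ arcosh (u t + e)).
      by apply: continuous_arcosh; have := ue _ tab'; lra.
    apply: cvgD; last exact: cvg_cst.
    by move/subspace_continuousP : cu; exact.
  have cab' : c \in `[a, b] by exact: subset_itv_oo_cc.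
  rewrite mulr_ge0 ?subr_ge0 ?(ltW ab)//.
  have S0 := sqrtr_sqrB1_gt0 (ue _ cab').
  have [g0 le_c] := le_u _ cab.
  have le_S : Num.sqrt (u c ^+ 2 - 1) <= Num.sqrt ((u c + e) ^+ 2 - 1).
    by rewrite ler_wsqrtr//; have := u1 _ cab'; nra.
  have : `|sg * ((Num.sqrt ((u c + e) ^+ 2 - 1))^-1 * u' c)| <= g c.
    rewrite !normrM sg1 mul1r ger0_norm ?invr_ge0 ?(ltW S0)//.
    rewrite ler_pdivrMl// (le_trans le_c)// ler_wpM2r//.
  by rewrite ler_norml => /andP[+ _]; rewrite -subr_ge0 opprK addrC.
have limit (sg : R) : `|sg| = 1 ->
    0 <= (G b + sg * arcosh (u b)) - (G a + sg * arcosh (u a)).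
  move=> sg1.
  have c1 t : t \in `[a, b] ->
      G t + sg * arcosh (u t + e) @[e --> 0^'+] --> G t + sg * arcosh (u t).
    move=> tab; apply: cvgD; first exact: cvg_cst.
    apply: cvgM; first exact: cvg_cst.
    apply: (@continuous_cvg _ _ _ _ _ _ arcosh (u t)).
      by apply: continuous_arcosh; have := u1 _ tab; lra.
    rewrite -[X in _ --> X]addr0; apply: cvgD; first exact: cvg_cst.
    exact: cvg_at_right_filter.
  have c2 := cvgB (c1 _ b_in) (c1 _ a_in).
  apply: (cvgr_to_ge (c2 _)).
  by near=> e; apply: perturbed.
have := limit 1 (normr1 _); have := limit (-1) (normrN1 _).
by rewrite ler_norml => *; apply/andP; split; lra.
Unshelve. all: by end_near. Qed.

End HyperbolicFunctions.

(** * Curves, lengths and explicit geodesics *)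

Section Distance.
Context {R : realType} {d : nat}.
Local Notation E := 'rV[R]_d.+1.
Implicit Types (x y z v w : E) (c W : R -> E).
Local Notation vel c := (deriv_on unit_itv c).

Lemma near_const_lorentz c W (t k : R) (c' W' : E) :
  (\forall s \near t, lorentz (c s) (W s) = k) ->
  is_derive t 1 c c' -> is_derive t 1 W W' ->
  lorentz c' (W t) + lorentz (c t) W' = 0.
Proof.
move=> ck Dc DW; apply: is_derive_unique (is_derive_lorentz Dc DW) _.
apply: near_eq_is_derive (is_derive_cst k t 1).
by apply: filterS ck => s ->.
Qed.

Lemma hyperboloid_velocity c (t : R) (c' : E) :
  (\forall s \near t, hyperboloid (c s)) -> is_derive t 1 c c' ->
  tangent (c t) c'.
Proof.
move=> hc dct; rewrite /tangent/=.
have : \forall s \near t, lorentz (c s) (c s) = -1 by apply: filterS hc => s [].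
move=> /near_const_lorentz/(_ dct dct); rewrite (lorentzC c'); lra.
Qed.

Lemma within_hnorm (A : set R) (f : R -> E) : {within A, continuous f} ->
  {within A, continuous (fun s => hnorm (f s))}.
Proof.
move=> cf t; apply: (@continuous_cvg _ _ _ _ _ _ Num.sqrt).
  exact: sqrt_continuous.
exact: within_lorentz.
Qed.

(** Apply the comparison of arcosh with a primitive to u = - <x, c>_L and to the
arc length G of c: since c' is tangent, |u'| <= sqrt (u^2 - 1) |c'|. *)
Lemma curve_length_ge x y c : joins x y c ->
  arcosh (- lorentz x y) <= curve_length c.
Proof.
move=> [C1c hc c0 c1].
have hx : hyperboloid x by rewrite -c0; exact/hc/unit_itv0.
have ch := within_hnorm C1c.2.
set h := (fun s => hnorm (vel c s)) in ch.
have ih : lebesgue_measure.-integrable `[0, 1] (EFin \o h).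
  by apply: continuous_compact_integrable => //; exact: segment_compact.
pose G t := parameterized_integral lebesgue_measure 0 t h.
have dG (t : R) : t \in `]0, 1[ -> is_derive t 1 G (h t).
  move=> t01; have := t01; rewrite in_itv/= => /andP[t0 t1].
  have [] := continuous_FTC1_closed t1 ih t0 (within_unit_continuous ch t01).
  by rewrite derive1E => dG1 <-; exact: derivableP.
have cG : {within `[0, 1], continuous G}.
  by apply: parameterized_integral_continuous.
have cx : {within `[0, 1], continuous (fun s => - lorentz x (c s))}.
  move=> t; apply: cvgN; apply: cvg_lorentz; first exact: cvg_cst.
  exact: C1_on_continuous.
have := @arcosh_le_primitive R 0 1 (fun s => - lorentz x (c s))
  (fun s => - lorentz x (vel c s)) G h ler01 cx cG.
have -> : G 0 = 0.
  by rewrite /G /parameterized_integral set_itv1 Rintegral_set1.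
have -> : G 1 = curve_length c by [].
rewrite c0 c1 subr0; case: (hx) => -> _; rewrite opprK arcosh1 subr0.
move=> H; apply: le_trans (ler_norm _) _; apply: H.
- by move=> t It; apply: lorentz_cosh_ge1 => //; exact: hc.
- move=> t t01.
  have := is_derive_lorentz (is_derive_cst x t 1) (C1_unit_derive C1c t01).
  by rewrite lorentz0l add0r => /is_deriveN.
- move=> t t01; split; first exact: hnorm_ge0.
  have hct := hc _ (unit_itv_oo t01).
  have tc : tangent (c t) (vel c t).
    apply: hyperboloid_velocity; last exact: C1_unit_derive.
    by have := unit_itv_interior t01; apply: filterS => s; exact: hc.
  by rewrite normrN sqrrN (lorentzC x (c t)); exact: tangent_pairing.
Qed.

(** The geodesic through x with initial velocity r n. *)
Definition hyp_arc x n (r t : R) : E := coshR (r * t) *: x + sinhR (r * t) *: n.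
Definition hyp_arc' x n (r t : R) : E :=
  r *: (sinhR (r * t) *: x + coshR (r * t) *: n).

Lemma is_derive_hyp_arc x n (r t : R) :
  is_derive t 1 (hyp_arc x n r) (hyp_arc' x n r t).
Proof.
apply: (is_derive_eq (is_deriveD
  (is_derive_scale (is_derive_cosh_scale r t) (is_derive_cst x t 1))
  (is_derive_scale (is_derive_sinh_scale r t) (is_derive_cst n t 1)))).
by rewrite !scaler0 !addr0 /hyp_arc' scalerDr !scalerA.
Qed.

Lemma is_derive_hyp_arc' x n (r t : R) :
  is_derive t 1 (hyp_arc' x n r) (r ^+ 2 *: hyp_arc x n r t).
Proof.
apply: (is_derive_eq (is_deriveZ r (is_deriveD
  (is_derive_scale (is_derive_sinh_scale r t) (is_derive_cst x t 1))
  (is_derive_scale (is_derive_cosh_scale r t) (is_derive_cst n t 1))))).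
by rewrite !scaler0 !addr0 /hyp_arc !scalerDr !scalerA expr2 !mulrA.
Qed.

Section Arc.
Variables (x n : E) (r : R).
Hypotheses (hx : hyperboloid x) (xn : lorentz x n = 0).
(* keeps the constant arc, for which n is the zero vector *)
Hypothesis nn : r = 0 \/ lorentz n n = 1.

Let sinh_nn t : sinhR (r * t) * lorentz n n = sinhR (r * t).
Proof. by case: nn => [->|->]; rewrite ?mulr1// mul0r sinhR0 mul0r. Qed.

Let arc_nn t : lorentz (hyp_arc x n r t) (hyp_arc x n r t) = -1.
Proof.
rewrite /hyp_arc !lorentzE (lorentzC n x) xn; case: hx => -> _.
have := sinh_nn t; have := coshR_sqr (r * t).
move: (sinhR _) (coshR _) => s c cs ss; rewrite !(mulr0, addr0, add0r) ss.
by rewrite mulrN1 mulrN -!expr2 cs; ring.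
Qed.

Lemma hyp_arc_hyperboloid t : hyperboloid (hyp_arc x n r t).
Proof.
split; first exact: arc_nn.
rewrite (lorentz_lt0_sheet hx (arc_nn t)) /hyp_arc !lorentzE xn mulr0 addr0.
by case: hx => -> _; rewrite mulrN1 oppr_lt0 coshR_gt0.
Qed.

Lemma hyp_arc_speed t :
  lorentz (hyp_arc' x n r t) (hyp_arc' x n r t) = r ^+ 2.
Proof.
rewrite /hyp_arc' !lorentzE (lorentzC n x) xn; case: hx => -> _.
have := coshR_sqr (r * t); case: nn => [->|->]; first by rewrite !mul0r expr0n.
move: (sinhR _) (coshR _) => s c cs; rewrite !(mulr0, addr0, add0r, mulr1).
by rewrite mulrN1 mulrN -!expr2 cs; ring.
Qed.

Lemma hyp_arc0 : hyp_arc x n r 0 = x.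
Proof. by rewrite /hyp_arc mulr0 coshR0 sinhR0 scale1r scale0r addr0. Qed.

Lemma hyp_arc_C1 : C1_on unit_itv (hyp_arc x n r) /\
  {in unit_itv, vel (hyp_arc x n r) =1 hyp_arc' x n r}.
Proof.
apply: smooth_C1_on; first exact: is_derive_hyp_arc.
exact: is_derive_continuous (is_derive_hyp_arc' x n r).
Qed.

Lemma hyp_arc'_C1 : C1_on unit_itv (hyp_arc' x n r) /\
  {in unit_itv, vel (hyp_arc' x n r) =1 (fun t => r ^+ 2 *: hyp_arc x n r t)}.
Proof.
apply: smooth_C1_on; first exact: is_derive_hyp_arc'.
move=> t; apply: cvgZ; first exact: cvg_cst.
exact: is_derive_continuous (is_derive_hyp_arc x n r) t.
Qed.

Lemma hyp_arc_geodesic : is_geodesic (hyp_arc x n r).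
Proof.
have [C1 v1] := hyp_arc_C1; have [C1' v1'] := hyp_arc'_C1.
have E2 : {in unit_itv, vel (vel (hyp_arc x n r)) =1
    (fun t => r ^+ 2 *: hyp_arc x n r t)}.
  move=> t It; rewrite -(v1' t It).
  exact: deriv_on_ext v1 (set_mem It).
split.
- split; first exact: C1.
  by apply: C1_on_ext C1' => s Is; rewrite v1.
- by move=> t _; exact: hyp_arc_hyperboloid.
- move=> t It; have It' := mem_set It.
  rewrite /cov_deriv /tproj (E2 t It') lorentzZr (arc_nn t).
  by rewrite mulrN1 scaleNr subrr.
Qed.

Lemma hyp_arc_length : 0 <= r -> curve_length (hyp_arc x n r) = r.
Proof.
move=> r0; have [_ v1] := hyp_arc_C1.
have E : {in unit_itv, (fun t => hnorm (vel (hyp_arc x n r) t)) =1 cst r}.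
  move=> t It; rewrite /= (v1 t It) /hnorm hyp_arc_speed sqrtr_sqr.
  exact: ger0_norm.
transitivity (\int[@lebesgue_measure R]_(t in unit_itv) (cst r t))%R.
  exact: eq_Rintegral.
have mu1 : lebesgue_measure (@unit_itv R) = 1%E.
  by rewrite /unit_itv lebesgue_measure_itv/= lte_fin ltr01 sube0.
transitivity (r * fine (lebesgue_measure (@unit_itv R))).
  by apply: Rintegral_cst; exact: measurable_itv.
by rewrite mu1 /= mulr1.
Qed.

End Arc.
End Distance.

(** * Closed forms of distance, logarithm and transport *)

Section Minimizers.
Context {R : realType} {d : nat}.
Local Notation E := 'rV[R]_d.+1.
Implicit Types (x y z v w : E) (c W : R -> E).
Local Notation vel c := (deriv_on unit_itv c).

(** The unit vector at x that points to y; it is 0 when x = y because the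
inverse of 0 is 0, and then the arc below is constant. *)
Definition direction x y : E :=
  (Num.sqrt (lorentz x y ^+ 2 - 1))^-1 *: (y + lorentz x y *: x).

Section Arc.
Variables (x y : E).
Hypotheses (hx : hyperboloid x) (hy : hyperboloid y).
Local Notation u := (- lorentz x y).
Local Notation arc := (hyp_arc x (direction x y) (arcosh u)).

Let u1 : 1 <= u. Proof. exact: lorentz_cosh_ge1. Qed.

Lemma direction_orth : lorentz x (direction x y) = 0.
Proof.
by rewrite /direction !lorentzE; case: hx => -> _; rewrite mulrN1 subrr mulr0.
Qed.

Lemma direction_unit : arcosh u = 0 \/
  lorentz (direction x y) (direction x y) = 1.
Proof.
have [ue|un] := eqVneq u 1; [left|right]; first by rewrite ue arcosh1.
have : 0 < Num.sqrt (u ^+ 2 - 1) by apply: sqrtr_sqrB1_gt0; rewrite lt_def un.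
have : Num.sqrt (u ^+ 2 - 1) ^+ 2 = u ^+ 2 - 1.
  by rewrite sqr_sqrtr//; have := u1; nra.
rewrite sqrrN /direction !lorentzE (lorentzC y x).
case: hx => -> _; case: hy => -> _.
move: (Num.sqrt _) => S; move: (lorentz x y) => k SE S0.
transitivity ((k ^+ 2 - 1) / S ^+ 2); first by field; rewrite gt_eqF.
by rewrite -SE divff// gt_eqF// exprn_gt0.
Qed.

Lemma arc_end : arc 1 = y.
Proof.
rewrite /hyp_arc mulr1 coshR_arcosh// sinhR_arcosh//.
have [ue|un] := eqVneq u 1.
  rewrite ue expr1n subrr sqrtr0 scale0r addr0 scale1r.
  exact: lorentz_eqN1.
rewrite /direction scalerA sqrrN divff; last first.
  rewrite -sqrrN gt_eqF// sqrtr_sqrB1_gt0// lt_def un//.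
by rewrite scale1r scaleNr addrC addrK.
Qed.

Lemma arc_joins : joins x y arc.
Proof.
split; first exact: (hyp_arc_C1 _ _ _).1.
- by move=> t _; apply: hyp_arc_hyperboloid => //;
    [exact: direction_orth|exact: direction_unit].
- exact: hyp_arc0.
- exact: arc_end.
Qed.

Lemma arc_length : curve_length arc = arcosh u.
Proof.
apply: hyp_arc_length => //; [exact: direction_orth|exact: direction_unit|].
exact: arcosh_ge0.
Qed.

(** The arc attains the lower bound that holds for every curve. *)
Lemma hdist_arcosh : hdist x y = arcosh u.
Proof.
have lb : lbound [set curve_length c | c in joins x y] (arcosh u).
  by move=> _ [c jc <-]; exact: curve_length_ge.
have mem : [set curve_length c | c in joins x y] (arcosh u).
  by exists arc; [exact: arc_joins|exact: arc_length].
apply/eqP; rewrite eq_le; apply/andP; split.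
  by apply: ge_inf => //; exists (arcosh u).
by apply: lb_le_inf => //; exists (arcosh u).
Qed.

Lemma arc_min_geodesic : is_min_geodesic x y arc.
Proof.
split; last by rewrite arc_length hdist_arcosh.
  apply: hyp_arc_geodesic => //; first exact: direction_orth.
  exact: direction_unit.
exact: arc_joins.
Qed.

End Arc.

Section GeodesicEquation.
Variable c : R -> E.
Hypothesis gc : is_geodesic c.
Local Notation v := (vel c 0).
Local Notation l := (hnorm v).

Let C1c : C1_on unit_itv c. Proof. by case: gc => -[]. Qed.
Let C2c : C1_on unit_itv (vel c). Proof. by case: gc => -[]. Qed.

Lemma geodesic_hyp (t : R) : unit_itv t -> hyperboloid (c t).
Proof. by case: gc => _ H _; exact: H. Qed.

Lemma geodesic_velocity (t : R) : t \in `]0, 1[ -> is_derive t 1 c (vel c t).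
Proof. exact: C1_unit_derive. Qed.

Let half : (2^-1 : R) \in `]0, 1[.
Proof. by rewrite in_itv/=; apply/andP; split; lra. Qed.

Let cc : {within unit_itv, continuous c}. Proof. exact: C1_on_continuous. Qed.
Let cv : {within unit_itv, continuous (vel c)}. Proof. by case: C1c. Qed.

Let near_hyp (t : R) : t \in `]0, 1[ -> \forall s \near t, hyperboloid (c s).
Proof.
by move=> t01; have := unit_itv_interior t01; apply: filterS; exact: geodesic_hyp.
Qed.

Lemma geodesic_tangent_oo (t : R) : t \in `]0, 1[ -> tangent (c t) (vel c t).
Proof.
by move=> t01; exact: hyperboloid_velocity (near_hyp t01) (geodesic_velocity t01).
Qed.

Let near_orth (t : R) : t \in `]0, 1[ ->
  \forall s \near t, lorentz (c s) (vel c s) = 0.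
Proof.
move=> t01; have := near_in_itvoo t01; apply: filterS => s s01.
exact: geodesic_tangent_oo.
Qed.

(** Differentiating <c, c'> = 0 gives <c, c''> = - <c', c'>, so that the vanishing
of the tangential part of c'' reads c'' = <c', c'> c. *)
Let derive_vel (t : R) : t \in `]0, 1[ ->
  is_derive t 1 (vel c) (lorentz (vel c t) (vel c t) *: c t).
Proof.
move=> t01; have dv := C1_unit_derive C2c t01.
apply: is_derive_eq dv _.
have E1 := near_const_lorentz (near_orth t01) (geodesic_velocity t01)
  (C1_unit_derive C2c t01).
case: gc => _ _ /(_ t (unit_itv_oo t01)).
rewrite /cov_deriv /tproj; have -> : lorentz (c t) (vel (vel c) t) =
  - lorentz (vel c t) (vel c t) by lra.
by rewrite scaleNr => /eqP; rewrite subr_eq0 => /eqP.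
Qed.

Let speed_const (t : R) : t \in unit_itv ->
  lorentz (vel c t) (vel c t) = lorentz v v.
Proof.
apply: (constant_on_unit (f := fun t => lorentz (vel c t) (vel c t))).
  exact: within_lorentz.
move=> s s01; have dv := derive_vel s01.
apply: is_derive_eq (is_derive_lorentz dv dv) _.
have := geodesic_tangent_oo s01; rewrite /tangent/= => o.
by rewrite !lorentzE (lorentzC (vel c s) (c s)) o mulr0 addr0.
Qed.

(** The square of the speed is conserved, and it is nonnegative at an inner
point, where c' is known to be tangent. *)
Lemma geodesic_speed : lorentz v v = l ^+ 2.
Proof.
rewrite /hnorm sqr_sqrtr// -(speed_const (mem_set (unit_itv_oo half))).
apply: tangent_ge0 (geodesic_tangent_oo half).
exact/geodesic_hyp/unit_itv_oo.
Qed.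

Lemma geodesic_accel (t : R) : t \in `]0, 1[ ->
  is_derive t 1 (vel c) (l ^+ 2 *: c t).
Proof.
move=> t01; have := derive_vel t01.
by rewrite (speed_const (mem_set (unit_itv_oo t01))) geodesic_speed.
Qed.

Lemma geodesic_tangent0 : tangent (c 0) v.
Proof.
rewrite /tangent/=.
suff : lorentz (c 2^-1) (vel c 2^-1) = lorentz (c 0) v.
  by move=> <-; exact: geodesic_tangent_oo.
apply: (constant_on_unit (f := fun t => lorentz (c t) (vel c t))).
- exact: within_lorentz.
- move=> s s01.
  apply: is_derive_eq (is_derive_lorentz (geodesic_velocity s01)
    (derive_vel s01)) _.
  rewrite lorentzZr; case: (geodesic_hyp (unit_itv_oo s01)) => -> _; ring.
- exact/mem_set/unit_itv_oo.
Qed.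

Let cosh_within : {within unit_itv, continuous (fun s => coshR (l * s))}.
Proof.
apply: continuous_subspaceT.
exact: is_derive_continuous (is_derive_cosh_scale l).
Qed.

Let sinh_within : {within unit_itv, continuous (fun s => sinhR (l * s))}.
Proof.
apply: continuous_subspaceT.
exact: is_derive_continuous (is_derive_sinh_scale l).
Qed.

Let combination_subr0 (a a' b b' : R) (w z : E) : a = a' -> b = b' ->
  (a *: w + b *: z) - (b' *: z + a' *: w) = 0.
Proof. by move=> -> ->; rewrite [X in _ - X]addrC subrr. Qed.

(** This and the next identity are first integrals of c'' = l^2 c; together they
determine c 1 and c' 1, with no division by l. *)
Let integral1 : (l * coshR l) *: c 1 - sinhR l *: vel c 1 = l *: c 0.
Proof.
pose f t := (l * coshR (l * t)) *: c t - sinhR (l * t) *: vel c t.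
have cf : {within unit_itv, continuous f}.
  move=> s; apply: cvgB; apply: cvgZ; last exact: cv.
  - by apply: cvgM; [exact: cvg_cst|exact: cosh_within].
  - exact: cc.
  - exact: sinh_within.
have df (s : R) : s \in `]0, 1[ -> is_derive s 1 f 0.
  move=> s01.
  apply: is_derive_eq (is_deriveB (is_derive_scale
     (is_deriveZ l (is_derive_cosh_scale l s)) (geodesic_velocity s01))
     (is_derive_scale (is_derive_sinh_scale l s) (geodesic_accel s01))) _.
  by rewrite /= !scalerA; apply: combination_subr0; rewrite /GRing.scale/= /sinhR /coshR; field.
have := constant_row_on_unit cf df (mem_set unit_itv1).
by rewrite /f !mulr1 mulr0 coshR0 sinhR0 mulr1 scale0r subr0.
Qed.

Let integral2 : coshR l *: vel c 1 - (l * sinhR l) *: c 1 = v.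
Proof.
pose f t := coshR (l * t) *: vel c t - (l * sinhR (l * t)) *: c t.
have cf : {within unit_itv, continuous f}.
  move=> s; apply: cvgB; apply: cvgZ; last exact: cc.
  - exact: cosh_within.
  - exact: cv.
  - by apply: cvgM; [exact: cvg_cst|exact: sinh_within].
have df (s : R) : s \in `]0, 1[ -> is_derive s 1 f 0.
  move=> s01.
  apply: is_derive_eq (is_deriveB
     (is_derive_scale (is_derive_cosh_scale l s) (geodesic_accel s01))
     (is_derive_scale (is_deriveZ l (is_derive_sinh_scale l s))
       (geodesic_velocity s01))) _.
  rewrite /= !scalerA.
  by apply: combination_subr0; rewrite /GRing.scale/= /sinhR /coshR; field.
have := constant_row_on_unit cf df (mem_set unit_itv1).
by rewrite /f !mulr1 mulr0 coshR0 sinhR0 mulr0 scale0r subr0 scale1r.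
Qed.

(** Eliminate c' 1 between the two first integrals, using cosh^2 - sinh^2 = 1. *)
Lemma geodesic_endpoint : l *: c 1 = (l * coshR l) *: c 0 + sinhR l *: v.
Proof.
have i1 k : l * c 0 0 k = l * coshR l * c 1 0 k - sinhR l * vel c 1 0 k.
  by have /rowP/(_ k) := integral1; rewrite !mxE => <-.
have i2 k : v 0 k = coshR l * vel c 1 0 k - l * sinhR l * c 1 0 k.
  by have /rowP/(_ k) := integral2; rewrite !mxE => <-.
apply/rowP => k; rewrite !mxE i2 mulrAC i1.
have := coshR_sqr l; move: (coshR l) (sinhR l) => p q pq.
by rewrite -[LHS]mulr1 -(addrK (q ^+ 2) 1) -pq; ring.
Qed.

Lemma geodesic_endvelocity : vel c 1 = (l * sinhR l) *: c 0 + coshR l *: v.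
Proof.
have i1 k : l * c 0 0 k = l * coshR l * c 1 0 k - sinhR l * vel c 1 0 k.
  by have /rowP/(_ k) := integral1; rewrite !mxE => <-.
have i2 k : v 0 k = coshR l * vel c 1 0 k - l * sinhR l * c 1 0 k.
  by have /rowP/(_ k) := integral2; rewrite !mxE => <-.
apply/rowP => k; rewrite !mxE i2 mulrAC i1.
have := coshR_sqr l; move: (coshR l) (sinhR l) => p q pq.
by rewrite -[LHS]mulr1 -(addrK (q ^+ 2) 1) -pq; ring.
Qed.

Lemma geodesic_static : l = 0 -> c 1 = c 0 /\ v = 0.
Proof.
move=> l0; have rest (t : R) : t \in `]0, 1[ -> vel c t = 0.
  move=> t01; apply: tangent_eq0 (geodesic_tangent_oo t01) _.
    exact/geodesic_hyp/unit_itv_oo.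
  by rewrite (speed_const (mem_set (unit_itv_oo t01))) geodesic_speed l0 expr0n.
split.
  apply: constant_row_on_unit (mem_set unit_itv1) => // t t01.
  by rewrite -(rest t t01); exact: geodesic_velocity.
rewrite -(rest _ half); apply/esym.
apply: constant_row_on_unit (mem_set (unit_itv_oo half)) => // t t01.
by have := geodesic_accel t01; rewrite l0 expr0n scale0r.
Qed.

End GeodesicEquation.

Section Log.
Variables (x y : E).
Hypothesis hx : hyperboloid x.

(** Any geodesic defined on the unit interval is determined by its ends: the
product with x of the formula for c 1 gives the speed, and then the formula
itself gives the velocity. *)
Lemma geodesic_direction c : is_geodesic c -> c 0 = x -> c 1 = y ->
  - lorentz x y = coshR (hnorm (vel c 0)) /\
  vel c 0 = arcosh_ratio (- lorentz x y) *: (y + lorentz x y *: x).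
Proof.
move=> gc c0 c1; have := geodesic_endpoint gc; have := geodesic_tangent0 gc.
have := geodesic_static gc.
rewrite c0 c1 /tangent/=.
set v := vel c 0; set l := hnorm v => static tv endp.
have l_ge0 : 0 <= l by exact: hnorm_ge0.
have [l0|l1] := eqVneq l 0.
  have [-> ->] := static l0; case: hx => -> _.
  by rewrite scaleN1r subrr scaler0 l0 opprK coshR0.
have lp : 0 < l by rewrite lt_def l1.
have s0 : 0 < sinhR l.
  by have /andP[+ _] := sinhR_bounds l_ge0; exact: lt_le_trans.
have uE : - lorentz x y = coshR l.
  apply: (mulfI l1); rewrite mulrN -lorentzZr endp !lorentzE tv.
  by case: hx => -> _; ring.
split=> //; rewrite uE /arcosh_ratio arcosh_coshR// sinhR_sqrt//.
have -> : (coshR l == 1) = false.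
  by apply/negP => /eqP l2; have := coshR_sqr l; rewrite l2; nra.
rewrite mulrC -scalerA scalerDr endp -[lorentz x y]opprK uE !scalerA mulrN.
by rewrite scaleNr addrAC subrr add0r scalerA mulVf ?scale1r// gt_eqF.
Qed.

Lemma hlogE : hyperboloid y ->
  hlog x y = arcosh_ratio (- lorentz x y) *: (y + lorentz x y *: x).
Proof.
move=> hy; apply: xget_unique.
  exists (hyp_arc x (direction x y) (arcosh (- lorentz x y))).
    exact: arc_min_geodesic.
  have [gc [_ _ c0 c1] _] := arc_min_geodesic hx hy.
  by have [_ <-] := geodesic_direction gc c0 c1.
move=> _ [c [gc [_ _ c0 c1] _] ->].
by have [_ ->] := geodesic_direction gc c0 c1.
Qed.

End Log.

Section Transport.
Variables (x y w : E).
Hypotheses (hx : hyperboloid x) (hy : hyperboloid y) (tw : tangent y w).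

Definition transport_formula : E :=
  w + (lorentz x w / (1 - lorentz x y)) *: (x + y).

(** One coordinate of the transport problem: l is the length of the geodesic,
p = cosh l, q = sinh l, X and Y are coordinates of the end points, V of the
initial velocity, a and b of the vector before and after transport, k is the
conserved product <W, c'> and K is <x, w>.  The last hypothesis is the
conservation of l^2 W - k c'; the factor q^2 = (p - 1) (p + 1) cancels. *)
Lemma transport_algebra (l k p q K X Y V a b : R) :
  l != 0 -> 0 < q -> 0 < 1 + p -> q * k = l * K -> p ^+ 2 = 1 + q ^+ 2 ->
  q * V = l * (X - p * Y) ->
  l ^+ 2 * b - k * (l * q * Y + p * V) = l ^+ 2 * a - k * V ->
  b = a + K / (1 + p) * (X + Y).
Proof.
move=> l0 q0 p0 kK pq VE H.
have qE : q ^+ 2 = (p - 1) * (1 + p) by lra.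
have H1 : l ^+ 2 * b = l ^+ 2 * a + k * (l * q * Y + (p - 1) * V) by lra.
have lq : l ^+ 2 * q ^+ 2 != 0.
  by rewrite mulf_neq0// expf_neq0//; exact: lt0r_neq0.
apply: (mulfI lq).
transitivity (l ^+ 2 * q ^+ 2 * a + l ^+ 2 * K * (p - 1) * (X + Y)).
  have -> : l ^+ 2 * q ^+ 2 * b = q ^+ 2 * (l ^+ 2 * b) by ring.
  rewrite H1.
  have -> : q ^+ 2 * (l ^+ 2 * a + k * (l * q * Y + (p - 1) * V)) =
    l ^+ 2 * q ^+ 2 * a + (q * k) * (l * q ^+ 2 * Y + (p - 1) * (q * V)).
    ring.
  by rewrite kK VE qE; ring.
by rewrite qE; field; rewrite gt_eqF.
Qed.

(** Along a geodesic c a parallel field has W' = k c with k = <W, c'> constant,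
and l^2 c = c'', so that l^2 W - k c' is conserved.  This determines W 1, and
in particular proves uniqueness of the transport. *)
Lemma parallel_endpoint c W : is_geodesic c -> c 0 = y -> c 1 = x ->
  is_parallel c W -> W 0 = w -> W 1 = transport_formula.
Proof.
move=> gc c0 c1 [C1W tW pW] W0.
have [uE _] := geodesic_direction hy gc c0 c1.
have := geodesic_endpoint gc; have := geodesic_endvelocity gc.
have := geodesic_tangent0 gc; have := geodesic_static gc.
rewrite c0 c1; set l := hnorm _ in uE *.
have C2c : C1_on unit_itv (vel c) by case: gc => -[].
have cv : {within unit_itv, continuous (vel c)} by exact: C1_on_continuous.
have cW : {within unit_itv, continuous W} by exact: C1_on_continuous.
have dW (t : R) : t \in `]0, 1[ ->
    is_derive t 1 W (lorentz (vel c t) (W t) *: c t).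
  move=> t01; have dW := C1_unit_derive C1W t01.
  apply: is_derive_eq dW _.
  have near_tW : \forall s \near t, lorentz (c s) (W s) = 0.
    by have := unit_itv_interior t01; apply: filterS => s; exact: tW.
  have := near_const_lorentz near_tW (geodesic_velocity gc t01)
    (C1_unit_derive C1W t01).
  have := pW t (unit_itv_oo t01); rewrite /cov_deriv /tproj => E1 E2.
  have E3 : lorentz (c t) (vel W t) = - lorentz (vel c t) (W t) by lra.
  by move: E1; rewrite E3 scaleNr => /eqP; rewrite subr_eq0 => /eqP.
have kE (t : R) : t \in unit_itv -> lorentz (vel c t) (W t) = lorentz (vel c 0) w.
  rewrite -W0.
  apply: (constant_on_unit (f := fun t => lorentz (vel c t) (W t))).
    exact: within_lorentz.
  move=> s s01.
  apply: is_derive_eq (is_derive_lorentz (geodesic_accel gc s01) (dW s s01)) _.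
  have := tW s (unit_itv_oo s01); rewrite /tangent/= => o.
  have := geodesic_tangent_oo gc s01; rewrite /tangent/= lorentzC => o'.
  by rewrite lorentzZl lorentzZr o o' !mulr0 addr0.
set k := lorentz (vel c 0) w in kE.
have first_integral : l ^+ 2 *: W 1 - k *: vel c 1 =
    l ^+ 2 *: W 0 - k *: vel c 0.
  have cf : {within unit_itv, continuous (fun t => l ^+ 2 *: W t - k *: vel c t)}.
    move=> s; apply: cvgB; apply: cvgZ; do ?[exact: cvg_cst].
      exact: cW.
    exact: cv.
  apply: (constant_row_on_unit cf _ (mem_set unit_itv1)) => s s01.
  apply: is_derive_eq (is_deriveB (is_deriveZ (l ^+ 2) (dW s s01))
    (is_deriveZ k (geodesic_accel gc s01))) _.
  by rewrite (kE s (mem_set (unit_itv_oo s01))) !scalerA mulrC subrr.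
move=> static tv v1 endp.
have [l0|l1] := eqVneq l 0.
  have [xy v0] := static l0.
  have -> : W 1 = W 0.
    apply: (constant_row_on_unit cW _ (mem_set unit_itv1)) => s s01.
    have := dW s s01; rewrite (kE s (mem_set (unit_itv_oo s01))) /k v0.
    by rewrite lorentz0l scale0r.
  by rewrite W0 /transport_formula xy tw mul0r scale0r addr0.
have s0 : 0 < sinhR l.
  have lp : 0 < l by rewrite lt_def l1 hnorm_ge0.
  by have /andP[+ _] := sinhR_bounds (ltW lp); exact: lt_le_trans.
have c1' : 0 < 1 + coshR l by have := coshR_gt0 l; lra.
have vE j : sinhR l * vel c 0 0 j = l * (x 0 j - coshR l * y 0 j).
  by have /rowP/(_ j) := endp; rewrite !mxE; lra.
have kl : sinhR l * k = l * lorentz x w.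
  rewrite /k -!lorentzZl endp !lorentzE tw; ring.
have uE' : lorentz x y = - coshR l by rewrite lorentzC -uE opprK.
rewrite /transport_formula uE' opprK; apply/rowP => j; rewrite !mxE.
have /rowP/(_ j) := first_integral; rewrite v1 W0 !mxE.
exact: transport_algebra l1 s0 c1' kl (coshR_sqr l) (vE j).
Qed.

(** Integrating W' = k c along the explicit arc gives a candidate; its value at
the end is known from the uniqueness argument. *)
Lemma parallel_exists : exists c W,
  [/\ is_min_geodesic y x c, is_parallel c W, W 0 = w &
      W 1 = transport_formula].
Proof.
set n := direction y x; set r := arcosh (- lorentz y x).
have yn : lorentz y n = 0 by exact: direction_orth.
have nn : r = 0 \/ lorentz n n = 1 by exact: direction_unit.
pose c := hyp_arc y n r.
pose k := lorentz n w.
pose W t := w + k *: (sinhR (r * t) *: y + (coshR (r * t) - 1) *: n).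
pose W' t := (k * r) *: c t.
have minc : is_min_geodesic y x c by exact: arc_min_geodesic.
clearbody n r.
have dW (t : R) : is_derive t 1 W (W' t).
  have d1 := is_derive_scale (is_derive_sinh_scale r t) (is_derive_cst y t 1).
  have d2 : is_derive t 1 (fun s => coshR (r * s) - 1) (r * sinhR (r * t)).
    have := is_deriveB (is_derive_cosh_scale r t) (is_derive_cst (1 : R) t 1).
    by rewrite subr0.
  have d3 := is_derive_scale d2 (is_derive_cst n t 1).
  have d4 := is_deriveD (is_derive_cst w t 1) (is_deriveZ k (is_deriveD d1 d3)).
  apply: is_derive_eq d4 _.
  by rewrite !scaler0 !addr0 add0r /W' /c /hyp_arc !scalerDr !scalerA !mulrA.
have cW' : continuous W'.
  move=> t; apply: cvgZ; first exact: cvg_cst.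
  exact: is_derive_continuous (is_derive_hyp_arc y n r) t.
have [C1W vW] := smooth_C1_on dW cW'.
have nn' t : sinhR (r * t) * lorentz n n = sinhR (r * t).
  by case: nn => ->; rewrite ?mulr1// mul0r sinhR0 mul0r.
have cn t : lorentz (c t) (W t) = 0.
  rewrite /c /W /hyp_arc !lorentzE (lorentzC n y) !yn tw -/k.
  case: (hy) => -> _; have := nn' t.
  move: (sinhR _) (coshR _) => s p sn; rewrite !(mulr0, addr0, add0r).
  transitivity (k * s + k * (p - 1) * (s * lorentz n n) - k * p * s).
    by ring.
  by rewrite sn; ring.
have pW : is_parallel c W.
  split=> //; first by move=> t _; exact: cn.
  move=> t It; rewrite /cov_deriv /tproj (vW t (mem_set It)) /W'.
  have [cct _] : hyperboloid (c t) by apply: hyp_arc_hyperboloid.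
  by rewrite lorentzZr cct mulrN1 scaleNr subrr.
have W0 : W 0 = w by rewrite /W mulr0 coshR0 sinhR0 subrr !scale0r addr0 scaler0 addr0.
exists c, W; split=> //.
have [gc [_ _ c0 c1] _] := minc.
exact: parallel_endpoint pW W0.
Qed.

Lemma transportE : transport x y w = transport_formula.
Proof.
apply: xget_unique.
  have [c [W [gc pW W0 W1]]] := parallel_exists; exists c, W; split=> //.
move=> z [c [W [[gc [_ _ c0 c1] _] pW W0 <-]]].
exact: parallel_endpoint pW W0.
Qed.

End Transport.
End Minimizers.

(** * Two interacting particles *)

Section Pair.
Context {R : realType} {d : nat}.
Local Notation E := 'rV[R]_d.+1.

(** The covariant derivative of log_x y when x and y move with velocities v and
w.  The quotient is the derivative of r / sinh r with respect to u = cosh r;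
at u = 1 it is 0 / 0 = 0, the value for which the formula stays true. *)
Definition log_rate (x y v w : E) : E :=
  let u := - lorentz x y in let g := arcosh_ratio u in
  ((1 - u * g) / (u ^+ 2 - 1) * - (lorentz y v + lorentz x w)) *:
     (y - u *: x) + g *: (w + lorentz x w *: x - u *: v).

(** The squared norm of T - v, where T is the transport of w to x; in this form,
since T has the norm of w, only one product involves both particles. *)
Definition discrepancy (x y v w : E) : R :=
  lorentz v v + lorentz w w - 2 * lorentz v (transport_formula x y w).

Section FixedTime.
Variables x y v w : E.
Hypotheses (hx : hyperboloid x) (hy : hyperboloid y).
Hypotheses (tv : tangent x v) (tw : tangent y w).
Local Notation u := (- lorentz x y).
Local Notation g := (arcosh_ratio u).
Local Notation p := (lorentz y v).
Local Notation q := (lorentz x w).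
Local Notation T := (transport_formula x y w).

Let u1 : 1 <= u. Proof. exact: lorentz_cosh_ge1. Qed.
Let xx : lorentz x x = -1. Proof. by case: hx. Qed.
Let yy : lorentz y y = -1. Proof. by case: hy. Qed.
Let u10 : 1 - lorentz x y != 0.
Proof. by rewrite gt_eqF//; have := u1; lra. Qed.

Lemma transport_pairing z :
  lorentz z T = lorentz z w + q / (1 - lorentz x y) * (lorentz z x + lorentz z y).
Proof. by rewrite /transport_formula !lorentzE. Qed.

Lemma transport_tangent : tangent x T.
Proof.
rewrite /tangent/= transport_pairing xx; field; exact: u10.
Qed.

Lemma transport_orth : lorentz y T = - q.
Proof.
by rewrite transport_pairing tw yy (lorentzC y x); field; exact: u10.
Qed.

Lemma transport_isometry : lorentz T T = lorentz w w.
Proof.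
rewrite transport_pairing [lorentz T w]lorentzC [lorentz T x]lorentzC.
rewrite [lorentz T y]lorentzC transport_orth transport_tangent transport_pairing.
rewrite (lorentzC w x) (lorentzC w y) tw; field; exact: u10.
Qed.

Lemma discrepancyE : discrepancy x y v w = hnorm (T - v) ^+ 2.
Proof.
rewrite (hnorm_sqr hx (tangentB transport_tangent tv)) /discrepancy.
rewrite -transport_isometry; move: (T) => z.
by rewrite !lorentzE (lorentzC z v); ring.
Qed.

Lemma discrepancy_ge0 : 0 <= discrepancy x y v w.
Proof. by rewrite discrepancyE sqr_ge0. Qed.

Lemma hnorm_transport : hnorm T = hnorm w.
Proof. by rewrite /hnorm transport_isometry. Qed.

(** The square of the radial component of z, <y, z>^2 / (u^2 - 1), is at most |z|^2. *)
Lemma pair_orthogonal_part z : tangent x z ->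
  lorentz y z ^+ 2 <= (u ^+ 2 - 1) * lorentz z z.
Proof.
move=> tz; have := tangent_pairing hx hy tz; rewrite -sqrrN => le_yz.
have S0 : 0 <= u ^+ 2 - 1 by have := u1; nra.
rewrite -(hnorm_sqr hx tz) -(sqr_sqrtr S0) -exprMn -[X in X <= _]real_normK//.
  by rewrite ler_sqr// nnegrE mulr_ge0 ?sqrtr_ge0.
exact: num_real.
Qed.

Lemma log_rate_pairing : lorentz v (log_rate x y v w) =
  (1 - u * g) / (u ^+ 2 - 1) * - (p + q) * p +
  g * (lorentz v w - u * lorentz v v).
Proof.
rewrite /log_rate !lorentzE (lorentzC v x) (lorentzC v y) tv.
by ring.
Qed.

Lemma tangent_log_rate : tangent x (log_rate x y v w).
Proof. by rewrite /tangent/= /log_rate !lorentzE xx tv; ring. Qed.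

(** The radial term is at most (u g - 1) (|v| + |w|), as |p|, |q| <= sinh r times
the speeds, and the other one at most u g (|v| + |w|); u g is r coth r. *)
Lemma hnorm_log_rate :
  hnorm (log_rate x y v w) <= 2 * (u * g) * (hnorm v + hnorm w).
Proof.
have v0 := hnorm_ge0 v; have w0 := hnorm_ge0 w; have g0 := arcosh_ratio_ge0 u1.
have ug := arcosh_ratioM_ge1 u1.
have tN : tangent x (y - u *: x).
  by rewrite /tangent/= !lorentzE xx; ring.
have tP : tangent x (w + q *: x) by exact: tangent_tproj.
have S0 : 0 <= u ^+ 2 - 1 by have := u1; nra.
have nN : hnorm (y - u *: x) = Num.sqrt (u ^+ 2 - 1).
  by rewrite /hnorm !lorentzE xx yy (lorentzC y x); congr Num.sqrt; ring.
have le_p : `|p| <= Num.sqrt (u ^+ 2 - 1) * hnorm v.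
  by rewrite sqrrN; exact: tangent_pairing.
have le_q : `|q| <= Num.sqrt (u ^+ 2 - 1) * hnorm w.
  by rewrite sqrrN (lorentzC x y); exact: tangent_pairing.
have nP : hnorm (w + q *: x) <= u * hnorm w.
  rewrite -ler_sqr ?nnegrE ?mulr_ge0 ?hnorm_ge0//; last by have := u1; lra.
  rewrite (hnorm_sqr hx tP) exprMn !lorentzE xx (lorentzC w x).
  rewrite -(hnorm_sqr hy tw).
  have : q ^+ 2 <= (u ^+ 2 - 1) * hnorm w ^+ 2.
    rewrite -(sqr_sqrtr S0) -exprMn -[X in X <= _]real_normK ?num_real//.
    by rewrite ler_sqr// nnegrE mulr_ge0 ?sqrtr_ge0.
  by lra.
have radial : hnorm (((1 - u * g) / (u ^+ 2 - 1) * - (p + q)) *: (y - u *: x))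
    <= (u * g - 1) * (hnorm v + hnorm w).
  rewrite hnormZ nN; have [ue|un] := eqVneq u 1.
    rewrite ue expr1n subrr sqrtr0 mulr0 arcosh_ratio1 mulr1 subrr mul0r.
    exact: lexx.
  have u2 : 1 < u by rewrite lt_def un.
  have S1 := sqrtr_sqrB1_gt0 u2.
  have SE := sqr_sqrtr S0.
  rewrite -[in X in `|X|]SE.
  move: (Num.sqrt _) S1 le_p le_q => S S1 le_p le_q.
  rewrite !normrM normrN normfV (ler0_norm (_ : 1 - u * g <= 0)); last by lra.
  rewrite opprB ger0_norm ?sqr_ge0// -!mulrA ler_wpM2l ?subr_ge0//.
  rewrite ler_pdivrMl ?exprn_gt0//.
  have := ler_normD p q; nra.
have tNs k := tangentZ k tN; have tPs k := tangentZ k (tangentB tP (tangentZ u tv)).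
rewrite /log_rate; apply: le_trans (hnormD hx (tNs _) (tPs _)) _.
have : hnorm (g *: (w + q *: x - u *: v)) <= g * (u * hnorm w + u * hnorm v).
  rewrite hnormZ (ger0_norm g0) ler_wpM2l//.
  apply: le_trans (hnormD hx tP (tangentN (tangentZ u tv))) _.
  by rewrite hnormN hnormZ ger0_norm ?lerD//; have := u1; lra.
by move: radial; lra.
Qed.

End FixedTime.

Section Dissipation.
Variables x y v w : E.
Hypotheses (hx : hyperboloid x) (hy : hyperboloid y).
Hypotheses (tv : tangent x v) (tw : tangent y w).
Local Notation T := (transport_formula x y w).

(** Here u = cosh r, g = r / sinh r, a and b are the squared speeds, s = <v, w>, p
and q pair each velocity with the other end point, and Q = <v, T>.  The
hypotheses on (p - q)^2 and (p + q)^2 say that the components of v + T and of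
v - T orthogonal to the geodesic have nonnegative squares X and Y.  After
multiplication by u^2 - 1, the difference of the two sides is a combination of X
and Y with coefficients g (u - 1) / 2 and g (u + 1) / 2 - 1: half of
r coth r - r / sinh r, and half of r coth r + r / sinh r - 2. *)
Lemma dissipation_algebra (u g p q a b s Q : R) :
  1 < u -> 0 <= g -> 2 <= g * (u + 1) ->
  s = Q - p * q / (1 + u) ->
  (p - q) ^+ 2 <= (u ^+ 2 - 1) * (a + b + 2 * Q) ->
  (p + q) ^+ 2 <= (u ^+ 2 - 1) * (a + b - 2 * Q) ->
  (1 - u * g) / (u ^+ 2 - 1) * - (p + q) * (p + q) +
    g * (2 * s - u * (a + b)) <= - (a + b - 2 * Q).
Proof.
move=> u1 g0 g2 -> I1 I2.
have S0 : 0 < u ^+ 2 - 1 by nra.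
have up : 1 + u != 0 by rewrite gt_eqF//; lra.
rewrite -(ler_pM2l S0) -subr_ge0.
set X := (u ^+ 2 - 1) * (a + b + 2 * Q) - (p - q) ^+ 2.
set Y := (u ^+ 2 - 1) * (a + b - 2 * Q) - (p + q) ^+ 2.
suff -> : (u ^+ 2 - 1) * - (a + b - 2 * Q) - (u ^+ 2 - 1) *
    ((1 - u * g) / (u ^+ 2 - 1) * - (p + q) * (p + q) +
     g * (2 * (Q - p * q / (1 + u)) - u * (a + b))) =
    g * (u - 1) / 2 * X + (g * (u + 1) / 2 - 1) * Y.
  have X0 : 0 <= X by rewrite subr_ge0.
  have Y0 : 0 <= Y by rewrite subr_ge0.
  have c1 : 0 <= g * (u - 1) / 2 by rewrite divr_ge0 ?mulr_ge0//; lra.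
  have c2 : 0 <= g * (u + 1) / 2 - 1 by lra.
  by rewrite addr_ge0// mulr_ge0.
by rewrite /X /Y; field; rewrite up gt_eqF.
Qed.

(** The vectors v + T and v - T are tangent at x, so their orthogonal parts have
nonnegative squares.  At a collision the two sides are equal. *)
Lemma dissipation :
  lorentz v (log_rate x y v w) + lorentz w (log_rate y x w v) <=
  - discrepancy x y v w.
Proof.
rewrite (log_rate_pairing y w tv) (log_rate_pairing x v tw).
have u1 := lorentz_cosh_ge1 hx hy.
have g0 := arcosh_ratio_ge0 u1; have g2 := arcosh_ratio_ge u1.
have tT := transport_tangent w hx hy.
have yT := transport_orth hx hy tw.
have TT := transport_isometry hx hy tw.
have I1 := pair_orthogonal_part hx hy (tangentD tv tT).
have I2 := pair_orthogonal_part hx hy (tangentB tv tT).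
have Qs := transport_pairing x y w v.
rewrite /discrepancy; move: (T) tT yT TT I1 I2 Qs => z tT yT TT I1 I2 Qs.
move: I1 I2; rewrite !lorentzE (lorentzC z v) yT TT => I1 I2.
rewrite (lorentzC y x) (lorentzC w v).
have [ue|un] := eqVneq (- lorentz x y) 1.
  have xy := lorentz_eqN1 hx hy ue.
  have p0 : lorentz y v = 0 by rewrite -xy.
  have q0 : lorentz x w = 0 by rewrite xy.
  by rewrite Qs ue p0 q0 arcosh_ratio1; lra.
have {un} u2 : 1 < - lorentz x y by rewrite lt_def un.
have sE : lorentz v w =
    lorentz v z - lorentz y v * lorentz x w / (1 + - lorentz x y).
  by rewrite Qs (lorentzC v x) tv (lorentzC v y); ring.
have := dissipation_algebra u2 g0 g2 sE (a := lorentz v v) (b := lorentz w w).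
move: (lorentz x y) (lorentz y v) (lorentz x w) I1 I2 => c p q I1 I2 H.
apply: le_trans (H _ _); last first.
- by move: I2; congr (_ <= _); ring.
- by move: I1; congr (_ <= _); ring.
by rewrite le_eqVlt; apply/orP; left; apply/eqP; ring.
Qed.

End Dissipation.

Section Moving.
Variables (X Y : R -> E) (t : R) (v w : E).
Hypotheses (hX : \forall s \near t, hyperboloid (X s)).
Hypotheses (hY : \forall s \near t, hyperboloid (Y s)).
Hypotheses (dX : is_derive t 1 X v) (dY : is_derive t 1 Y w).
Local Notation x := (X t).
Local Notation y := (Y t).
Local Notation u := (- lorentz x y).

Let hx : hyperboloid x. Proof. exact: nbhs_singleton hX. Qed.
Let hy : hyperboloid y. Proof. exact: nbhs_singleton hY. Qed.
Let tv : tangent x v. Proof. exact: hyperboloid_velocity. Qed.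
Let tw : tangent y w. Proof. exact: hyperboloid_velocity. Qed.

Lemma is_derive_pairing : is_derive t 1 (fun s => - lorentz (X s) (Y s))
  (- (lorentz y v + lorentz x w)).
Proof.
have := is_deriveN (is_derive_lorentz dX dY).
by rewrite (lorentzC v).
Qed.

(** The ambient derivative of log_x y, with - (<y, v> + <x, w>) for the derivative
of u; its tangential part is [log_rate]. *)
Definition log_derivative : E :=
  let g := arcosh_ratio u in
  ((1 - u * g) / (u ^+ 2 - 1) * - (lorentz y v + lorentz x w)) *:
     (y - u *: x) + g *: (w + (lorentz y v + lorentz x w) *: x - u *: v).

(** Away from collisions this is the product rule for g (y - u x). *)
Lemma is_derive_hlog :
  is_derive t 1 (fun s => hlog (X s) (Y s)) log_derivative.
Proof.
pose N s := Y s + lorentz (X s) (Y s) *: X s.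
pose a s := arcosh_ratio (- lorentz (X s) (Y s)).
have dN : is_derive t 1 N (w + (lorentz y v + lorentz x w) *: x - u *: v).
  apply: is_derive_eq (is_deriveD dY
    (is_derive_scale (is_derive_lorentz dX dY) dX)) _.
  by rewrite (lorentzC v) addrA scaleNr opprK.
suff daN : is_derive t 1 (fun s => a s *: N s) log_derivative.
  apply: near_eq_is_derive daN; near=> s.
  have hXs : hyperboloid (X s) by near: s.
  have hYs : hyperboloid (Y s) by near: s.
  by rewrite (hlogE hXs hYs).
have u1 := lorentz_cosh_ge1 hx hy.
have du := is_derive_pairing.
have [ue|un] := eqVneq u 1; last first.
  have u2 : 1 < u by rewrite lt_def un.
  have da : is_derive t 1 a ((1 - u * arcosh_ratio u) / (u ^+ 2 - 1) *
     - (lorentz y v + lorentz x w)).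
    exact: (@is_derive1_comp _ arcosh_ratio
      (fun s => - lorentz (X s) (Y s)) _ _ _ (is_derive_arcosh_ratio u2) du).
  apply: is_derive_eq (is_derive_scale da dN) _.
  by rewrite /log_derivative /N /a !scaleNr !opprK.
(* arcosh_ratio is only known to be continuous at 1, but its cofactor N vanishes
   there, so the difference quotient is that of N times a function tending to 1 *)
have N0 : N t = 0.
  by rewrite /N -(lorentz_eqN1 hx hy ue); case: hx => -> _; rewrite scaleN1r subrr.
have -> : log_derivative = w + (lorentz y v + lorentz x w) *: x - u *: v.
  by rewrite /log_derivative ue arcosh_ratio1 mulr1 subrr !mul0r scale0r add0r
    scale1r.
apply/is_derive_diff_quot; move/is_derive_diff_quot : dN => dN.
have ca : a s @[s --> t^'] --> (1 : R).
  apply: (@arcosh_ratio_cvg1 _ _ _ _ (fun s => - lorentz (X s) (Y s))).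
    apply: nbhs_dnbhs; near=> s; apply: lorentz_cosh_ge1; first by near: s.
    by near: s.
  have cu : {for t, continuous (fun s => - lorentz (X s) (Y s))}.
    apply/differentiable_continuous/derivable1_diffP.
    by have [] := du.
  by rewrite -ue; apply: cvg_trans cu; apply: cvg_app; exact: nbhs_dnbhs.
set m := (X in _ --> X) in dN *.
have caN : a s *: diff_quot N t s @[s --> t^'] --> 1 *: m by exact: cvgZ.
rewrite scale1r in caN; apply: cvg_trans caN.
apply: near_eq_cvg; near=> s.
by rewrite /= /diff_quot N0 !subr0 scaler0 subr0 !scalerA mulrC.
Unshelve. all: by end_near. Qed.

Lemma tproj_log_derivative : tproj x log_derivative = log_rate x y v w.
Proof.
have tL : tangent x (log_rate x y v w) by exact: tangent_log_rate.
have -> : log_derivative =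
    log_rate x y v w + (arcosh_ratio u * lorentz y v) *: x.
  by apply/rowP => k; rewrite /log_derivative /log_rate !mxE; ring.
move: (log_rate x y v w) tL => z tz; rewrite /tproj !lorentzE tz.
by case: hx => -> _; rewrite mulrN1 add0r scaleNr addrK.
Qed.

(* v' and w' are ambient derivatives; the accelerations are their tangential parts *)
Variables (V W : R -> E) (v' w' : E).
Hypotheses (tV : \forall s \near t, tangent (X s) (V s)).
Hypotheses (tW : \forall s \near t, tangent (Y s) (W s)).
Hypotheses (Vt : V t = v) (Wt : W t = w).
Hypotheses (dV : is_derive t 1 V v') (dW : is_derive t 1 W w').
Local Notation a := (tproj x v').
Local Notation b := (tproj y w').

(** Apart from the terms with accelerations a and b, differentiating <v, T> leaves
a curvature term, which vanishes for parallel transport in flat space. *)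
Definition discrepancy_derivative : R :=
  2 * lorentz v a + 2 * lorentz w b -
  2 * (lorentz a (transport_formula x y w) + lorentz (transport_formula y x v) b +
   (lorentz v v * lorentz x w + lorentz w w * lorentz y v +
    (lorentz y v + lorentz x w) * lorentz v (transport_formula x y w)) /
   (1 - lorentz x y)).

Lemma is_derive_discrepancy :
  is_derive t 1 (fun s => discrepancy (X s) (Y s) (V s) (W s))
    discrepancy_derivative.
Proof.
have u1 := lorentz_cosh_ge1 hx hy.
have xv' : lorentz x v' = - lorentz v v.
  have := near_const_lorentz tV dX dV; rewrite Vt; lra.
have yw' : lorentz y w' = - lorentz w w.
  have := near_const_lorentz tW dY dW; rewrite Wt; lra.
have u0 : 1 - lorentz x y != 0 by rewrite gt_eqF//; lra.
have dg : is_derive t 1 (fun s => 1 - lorentz (X s) (Y s))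
    (- (lorentz v y + lorentz x w)).
  apply: is_derive_eq (is_deriveB (is_derive_cst (1 : R) t 1)
    (is_derive_lorentz dX dY)) _.
  by rewrite sub0r.
have dgV := is_deriveV (u0 : (fun s => 1 - lorentz (X s) (Y s)) t != 0) dg.
have dnum := is_derive_mul (is_derive_lorentz dX dW) (is_derive_lorentz dY dV).
have dvv := is_derive_lorentz dV dV; have dww := is_derive_lorentz dW dW.
have dvw := is_derive_lorentz dV dW.
have dall := is_deriveB (is_deriveD dvv dww)
  (is_deriveZ 2 (is_deriveD dvw (is_derive_mul dnum dgV))).
apply: (near_eq_is_derive (f := fun s => lorentz (V s) (V s) +
    lorentz (W s) (W s) - 2 * (lorentz (V s) (W s) +
    lorentz (X s) (W s) * lorentz (Y s) (V s) / (1 - lorentz (X s) (Y s))))).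
  near=> s; rewrite /discrepancy transport_pairing (lorentzC (V s) (X s)).
  have -> : lorentz (X s) (V s) = 0 by near: s.
  by rewrite (lorentzC (V s) (Y s)); ring.
apply: is_derive_eq dall _.
rewrite /discrepancy_derivative /transport_formula /tproj /GRing.scale/=.
rewrite Vt Wt !lorentzE xv' yw'.
rewrite (lorentzC v' v) (lorentzC w' w) (lorentzC v' w) (lorentzC w v).
have vx : lorentz v x = 0 by rewrite lorentzC.
have wy : lorentz w y = 0 by rewrite lorentzC.
rewrite (lorentzC v' x) xv' (lorentzC v' y) (lorentzC y x) (lorentzC v y).
rewrite vx wy; case: hx => -> _; case: hy => -> _.
by field.
Unshelve. all: by end_near. Qed.

(** The curvature term is bounded because <y, v> and <x, w> are at most
sinh r <= 1 + cosh r times the speeds, which the denominator absorbs. *)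
Lemma discrepancy_derivative_le (B A : R) :
  hnorm v <= B -> hnorm w <= B -> hnorm a <= A -> hnorm b <= A ->
  `|discrepancy_derivative| <= 8 * (A * B + B ^+ 3).
Proof.
move=> vB wB aA bA.
have u1 := lorentz_cosh_ge1 hx hy.
have v0 := hnorm_ge0 v; have w0 := hnorm_ge0 w.
have a0 := hnorm_ge0 a; have b0 := hnorm_ge0 b.
have ta : tangent x a by exact: tangent_tproj.
have tb : tangent y b by exact: tangent_tproj.
have tT : tangent x (transport_formula x y w) by exact: transport_tangent.
have tT' : tangent y (transport_formula y x v) by exact: transport_tangent.
have nT : hnorm (transport_formula x y w) = hnorm w by exact: hnorm_transport.
have nT' : hnorm (transport_formula y x v) = hnorm v by exact: hnorm_transport.
have bnd (z1 z2 C D : R) : 0 <= z1 -> 0 <= z2 -> z1 <= C -> z2 <= D ->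
    z1 * z2 <= C * D by move=> *; exact: ler_pM.
have va : `|lorentz v a| <= A * B.
  by apply: le_trans (tangent_CS hx tv ta) _; rewrite mulrC; exact: bnd.
have wb : `|lorentz w b| <= A * B.
  by apply: le_trans (tangent_CS hy tw tb) _; rewrite mulrC; exact: bnd.
have aT : `|lorentz a (transport_formula x y w)| <= A * B.
  by apply: le_trans (tangent_CS hx ta tT) _; rewrite nT; exact: bnd.
have Tb : `|lorentz (transport_formula y x v) b| <= A * B.
  by apply: le_trans (tangent_CS hy tT' tb) _; rewrite nT' mulrC; exact: bnd.
have vT : `|lorentz v (transport_formula x y w)| <= B ^+ 2.
  by apply: le_trans (tangent_CS hx tv tT) _; rewrite nT expr2; exact: bnd.
have vv : `|lorentz v v| <= B ^+ 2.
  by apply: le_trans (tangent_CS hx tv tv) _; rewrite expr2; exact: bnd.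
have ww : `|lorentz w w| <= B ^+ 2.
  by apply: le_trans (tangent_CS hy tw tw) _; rewrite expr2; exact: bnd.
have B0 : 0 <= B by exact: le_trans vB.
(* sinh r <= 1 + cosh r *)
have S_le : Num.sqrt (lorentz x y ^+ 2 - 1) <= 1 - lorentz x y.
  rewrite -ler_sqr ?nnegrE ?sqrtr_ge0//; last by lra.
  by rewrite sqr_sqrtr; nra.
have pB : `|lorentz y v| <= (1 - lorentz x y) * B.
  by apply: le_trans (tangent_pairing hx hy tv) _; apply: bnd; rewrite ?sqrtr_ge0.
have qB : `|lorentz x w| <= (1 - lorentz x y) * B.
  apply: le_trans (tangent_pairing hy hx tw) _; rewrite (lorentzC y x).
  by apply: bnd; rewrite ?sqrtr_ge0.
have c0 : 0 < 1 - lorentz x y by lra.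
rewrite /discrepancy_derivative.
set curv := (X in 2 * (_ + _ + X)).
have le_curv : `|curv| <= 4 * B ^+ 3.
  rewrite /curv normrM normfV (gtr0_norm c0) ler_pdivrMr//.
  have H z1 z2 : `|z1| <= B ^+ 2 -> `|z2| <= (1 - lorentz x y) * B ->
      `|z1 * z2| <= (1 - lorentz x y) * B ^+ 3.
    move=> h1 h2; rewrite normrM.
    have -> : (1 - lorentz x y) * B ^+ 3 = B ^+ 2 * ((1 - lorentz x y) * B)
      by ring.
    exact: ler_pM.
  have h1 := H _ _ vv qB; have h2 := H _ _ ww pB.
  have h3 := H _ _ vT pB; have h4 := H _ _ vT qB.
  move: h1 h2 h3 h4; rewrite !ler_norml.
  by move=> /andP[? ?] /andP[? ?] /andP[? ?] /andP[? ?]; apply/andP; split; lra.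
move: curv le_curv => k; move: va wb aT Tb; rewrite !ler_norml.
move=> /andP[? ?] /andP[? ?] /andP[? ?] /andP[? ?] /andP[? ?].
by have B3 : 0 <= B ^+ 3 by [exact: exprn_ge0]; apply/andP; split; lra.
Qed.

End Moving.

End Pair.

(** * Dissipation with a Lipschitz rate *)

Section Barbalat.
Context {R : realType}.

(** A quantitative form of Barbalat's lemma without integrals.  If f t > e at a
late time, then f >= e / 2 on an interval of fixed length h after t, on which F
drops by c (e / 2) h; this is impossible once F is that close to its infimum. *)
Lemma lipschitz_dissipation_cvg0 (F F' f : R -> R) (c L : R) :
  0 < c -> 0 <= L ->
  (forall t, 1 <= t -> 0 <= F t) -> (forall t, 1 <= t -> 0 <= f t) ->
  (forall t : R, 1 <= t -> is_derive t 1 F (F' t)) ->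
  (forall t, 1 <= t -> F' t <= - (c * f t)) ->
  (forall s t, 1 <= s -> s <= t -> `|f t - f s| <= L * (t - s)) ->
  f @ +oo --> (0 : R).
Proof.
move=> c0 L0 F0 f0 dF F'f lipf.
have mvt s t : 1 <= s -> s < t ->
    exists2 z, s < z < t & F t - F s <= - (c * f z) * (t - s).
  move=> s1 st; have [z zst ->] : exists2 z, z \in `]s, t[ &
      F t - F s = F' z * (t - s).
    apply: MVT => // [z|]; first by rewrite in_itv/= => /andP[sz _]; apply: dF; lra.
    apply: derivable_within_continuous => z; rewrite in_itv/= => /andP[sz _].
    by have [] := dF z (le_trans s1 sz).
  move: zst; rewrite in_itv/= => /andP[sz zt].
  exists z; first by rewrite sz zt.
  by rewrite ler_wpM2r ?subr_ge0 ?(ltW st)// F'f//; lra.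
have decF s t : 1 <= s -> s <= t -> F t <= F s.
  move=> s1; rewrite le_eqVlt => /predU1P[->//|st].
  have [z /andP[sz zt] le_F] := mvt _ _ s1 st.
  rewrite -subr_le0 (le_trans le_F)// mulNr oppr_le0.
  by rewrite !mulr_ge0 ?(ltW c0) ?f0// ?subr_ge0; lra.
apply/cvgrPdist_le => e e0.
pose h := e / 2 / (L + 1).
have h0 : 0 < h by rewrite !divr_gt0//; lra.
have Lh : L * h <= e / 2.
  by rewrite /h mulrA ler_pdivrMr; [nra|lra].
pose S := [set F t | t in [set t | 1 <= t]].
have infS : has_inf S.
  split; first by exists (F 1), 1 => /=.
  by exists 0 => _ [t /= t1 <-]; exact: F0.
have [_ [T /= T1 <-] FT] :
    exists2 y, S y & y < inf S + c * (e / 2) * h.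
  by apply: inf_adherent => //; rewrite mulr_gt0// mulr_gt0// divr_gt0.
near=> t.
have tT : T <= t by near: t; apply: nbhs_pinfty_ge; exact: num_real.
have t1 : 1 <= t by lra.
rewrite sub0r normrN ger0_norm ?f0// leNgt; apply/negP => ft.
have [z /andP[tz zth] le_F] := mvt t (t + h) t1 ltac:(lra).
have zt : `|f z - f t| <= e / 2.
  apply: le_trans (lipf _ _ t1 (ltW tz)) _; apply: le_trans Lh.
  by rewrite ler_wpM2l//; lra.
have fz : e / 2 <= f z by move: zt; rewrite ler_norml => /andP[+ _]; lra.
have FtT := decF _ _ T1 tT.
have inf_le : inf S <= F (t + h).
  by apply: ge_inf; [case: infS|exists (t + h) => //=; lra].
have : c * (e / 2) * h <= c * f z * h.
  by rewrite ler_wpM2r ?(ltW h0)// ler_wpM2l// ltW.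
have hE : t + h - t = h by ring.
by rewrite hE in le_F; lra.
Unshelve. all: by end_near. Qed.

End Barbalat.

(** * Solutions of the alignment system *)

Section Solution.
Context {R : realType} {d N : nat}.
Local Notation E := 'rV[R]_d.+1.
Variables (kappa : R) (phi : R -> R) (x0 v0 : 'I_N -> E) (x v : 'I_N -> R -> E).
Hypothesis kappa_gt0 : 0 < kappa.
Hypothesis phi_ge0 : forall r : R, 0 <= r -> 0 <= phi r.
Variable Lip : R.
Hypothesis Lip_ge0 : 0 <= Lip.
Hypothesis phi_lip : forall a b, 0 <= a -> 0 <= b ->
  `|phi a - phi b| <= Lip * `|a - b|.
Variable M : R.
Hypothesis phi_sup : forall r, 0 <= r -> rcoth r * phi r <= M.
Hypothesis sol : is_global_solution kappa phi x0 v0 x v.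

Local Notation vel' i t := (deriv_on half_line (v i) t).
Local Notation acc i t := (tproj (x i t) (vel' i t)).
Local Notation rate i j t := (log_rate (x i t) (x j t) (v i t) (v j t)).
Local Notation gap i j t := (discrepancy (x i t) (x j t) (v i t) (v j t)).
Local Notation weight i j t := (phi (hdist (x i t) (x j t))).
Local Notation ucosh i j t := (- lorentz (x i t) (x j t)).

Lemma sol_on (i : 'I_N) (t : R) : 0 < t -> hyperboloid (x i t).
Proof. by move=> t0; apply: (sol_hyp sol); exact: ltW. Qed.

Lemma sol_tangent (i : 'I_N) (t : R) : 0 < t -> tangent (x i t) (v i t).
Proof. by move=> t0; apply: (sol_tan sol); exact: ltW. Qed.

Lemma near_sol_on (i : 'I_N) (t : R) : 0 < t ->
  \forall s \near t, hyperboloid (x i s).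
Proof.
by move=> t0; have := lt_nbhsr t0; apply: filterS => s; exact: sol_on.
Qed.

Lemma near_sol_tangent (i : 'I_N) (t : R) : 0 < t ->
  \forall s \near t, tangent (x i s) (v i s).
Proof.
by move=> t0; have := lt_nbhsr t0; apply: filterS => s; exact: sol_tangent.
Qed.

Let mem_half_line (t : R) : 0 < t -> half_line t.
Proof. by move=> t0; rewrite /half_line/= in_itv/= andbT ltW. Qed.

Lemma sol_derive_x (i : 'I_N) (t : R) : 0 < t -> is_derive t 1 (x i) (v i t).
Proof.
move=> t0; rewrite -(sol_pos sol i t0).
apply: deriv_on_interior; first exact: half_line_interior.
by case: (sol_C2 sol i) => -[H _] _; exact/H/mem_half_line.
Qed.

Lemma sol_derive_v (i : 'I_N) (t : R) : 0 < t -> is_derive t 1 (v i) (vel' i t).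
Proof.
move=> t0; apply: deriv_on_interior; first exact: half_line_interior.
by case: (sol_C1 sol i) => H _; exact/H/mem_half_line.
Qed.

(** At positive times the derivative along the half line is the two-sided one,
so the equation can be read with the explicit derivative of the logarithm. *)
Lemma sol_acc (i : 'I_N) (t : R) : 0 < t ->
  acc i t = (kappa / N%:R) *: \sum_(j < N) weight i j t *: rate i j t.
Proof.
move=> t0; have := sol_vel sol i t0; rewrite {1}/cov_deriv => ->.
congr (_ *: _); apply: eq_bigr => j _; congr (_ *: _); rewrite /cov_deriv.
have PF : ProperFilter (within (@half_line R) t^').
  rewrite within_absorb; first exact: Proper_dnbhs_numFieldType.
  by apply: nbhs_dnbhs; exact: half_line_interior.
have dlog := is_derive_hlog (near_sol_on i t0) (near_sol_on j t0)
  (sol_derive_x i t0) (sol_derive_x j t0).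
have [_ ->] := is_derive_deriv_on PF dlog.
by apply: tproj_log_derivative; [exact: near_sol_on|exact: sol_derive_x].
Qed.

Lemma sol_hdist (i j : 'I_N) (t : R) : 0 < t ->
  hdist (x i t) (x j t) = arcosh (ucosh i j t).
Proof. by move=> t0; apply: hdist_arcosh; exact: sol_on. Qed.

Lemma sol_hdist_ge0 (i j : 'I_N) (t : R) : 0 < t -> 0 <= hdist (x i t) (x j t).
Proof.
move=> t0; rewrite sol_hdist//; apply: arcosh_ge0; apply: lorentz_cosh_ge1;
exact: sol_on.
Qed.

Lemma weight_ge0 (i j : 'I_N) (t : R) : 0 < t -> 0 <= weight i j t.
Proof. by move=> t0; apply/phi_ge0/sol_hdist_ge0. Qed.

Lemma weight_ratio (i j : 'I_N) (t : R) : 0 < t ->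
  weight i j t * (ucosh i j t * arcosh_ratio (ucosh i j t)) <= M.
Proof.
move=> t0; have := phi_sup (sol_hdist_ge0 i j t0).
rewrite [X in rcoth X]sol_hdist// rcoth_arcosh 1?mulrC//.
by apply: lorentz_cosh_ge1; exact: sol_on.
Qed.

Lemma weight_le (i j : 'I_N) (t : R) : 0 < t -> weight i j t <= M.
Proof.
move=> t0; apply: le_trans (weight_ratio i j t0).
rewrite ler_peMr ?weight_ge0//; apply: arcosh_ratioM_ge1.
by apply: lorentz_cosh_ge1; exact: sol_on.
Qed.

Lemma weight_sym (i j : 'I_N) (t : R) : 0 < t -> weight i j t = weight j i t.
Proof. by move=> t0; rewrite !sol_hdist// (lorentzC (x j t)). Qed.

Definition energy (t : R) : R := \sum_(i < N) lorentz (v i t) (v i t).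
Definition power (t : R) : R := 2 * \sum_(i < N) lorentz (v i t) (acc i t).

Lemma energy_derive (t : R) : 0 < t -> is_derive t 1 energy (power t).
Proof.
move=> t0.
have -> : energy = \sum_(i < N) (fun s => lorentz (v i s) (v i s)).
  by apply/funext => s; rewrite /energy fct_sumE.
have dE := is_derive_sum (fun i : 'I_N =>
  is_derive_lorentz (sol_derive_v i t0) (sol_derive_v i t0)).
apply: is_derive_eq dE _; rewrite /power mulr_sumr; apply: eq_bigr => i _.
rewrite /tproj lorentzDr lorentzZr (lorentzC (v i t) (x i t)).
by rewrite (sol_tangent i t0) mulr0 addr0 (lorentzC (vel' i t)); ring.
Qed.

(** Exchange the indices in half of the double sum and apply the dissipation
estimate to each pair. *)
Lemma power_le (t : R) : 0 < t ->
  power t <= - (kappa / N%:R * \sum_(i < N) \sum_(j < N) weight i j t * gap i j t).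
Proof.
move=> t0.
have kN : 0 <= kappa / N%:R by rewrite divr_ge0// ltW.
have -> : power t = kappa / N%:R * \sum_(i < N) \sum_(j < N)
    weight i j t * (lorentz (v i t) (rate i j t) + lorentz (v j t) (rate j i t)).
  rewrite /power.
  under eq_bigr => i _.
    rewrite sol_acc// lorentzZr lorentz_sumr.
    under eq_bigr => j _ do rewrite lorentzZr.
    over.
  rewrite -mulr_sumr mulrCA; congr (_ * _).
  under [RHS]eq_bigr => i _.
    under eq_bigr => j _ do rewrite mulrDr.
    rewrite big_split/=; over.
  rewrite big_split/= [X in _ = _ + X]exchange_big/=.
  rewrite mulr_natl mulr2n; congr (_ + _); apply: eq_bigr => j _.
  by apply: eq_bigr => i _; rewrite weight_sym.
rewrite -mulrN ler_wpM2l// -sumrN; apply: ler_sum => i _.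
rewrite -sumrN; apply: ler_sum => j _; rewrite -mulrN ler_wpM2l ?weight_ge0//.
by apply: dissipation; by [exact: sol_on|exact: sol_tangent].
Qed.

Lemma gap_ge0 (i j : 'I_N) (t : R) : 0 < t -> 0 <= gap i j t.
Proof.
by move=> t0; apply: discrepancy_ge0; by [exact: sol_on|exact: sol_tangent].
Qed.

Lemma power_le_pair (i j : 'I_N) (t : R) : 0 < t ->
  power t <= - (kappa / N%:R * (weight i j t * gap i j t)).
Proof.
move=> t0; apply: le_trans (power_le t0) _; rewrite lerN2 ler_wpM2l//.
  by rewrite divr_ge0// ltW.
rewrite (bigD1 i)//= (bigD1 j)//= -addrA lerDl addr_ge0//.
  by apply: sumr_ge0 => k _; rewrite mulr_ge0 ?weight_ge0 ?gap_ge0.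
apply: sumr_ge0 => k _; apply: sumr_ge0 => l _.
by rewrite mulr_ge0 ?weight_ge0 ?gap_ge0.
Qed.

(** The equations hold at positive times only, so time 1 serves as the origin. *)
Let speed : R := Num.sqrt (energy 1).

Lemma energy_ge0 (t : R) : 0 < t -> 0 <= energy t.
Proof.
move=> t0; apply: sumr_ge0 => i _.
exact: tangent_ge0 (sol_on i t0) (sol_tangent i t0).
Qed.

Lemma energy_le (t : R) : 1 <= t -> energy t <= energy 1.
Proof.
move=> t1; have [c c1 E] : exists2 c, c \in `[1, t] &
    energy t - energy 1 = power c * (t - 1).
  apply: MVT_segment => // [s|].
    rewrite in_itv/= => /andP[s1 _]; apply: energy_derive; lra.
  apply: derivable_within_continuous => s; rewrite in_itv/= => /andP[s1 _].
  by have [] := energy_derive (lt_le_trans ltr01 s1).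
move: c1; rewrite in_itv/= => /andP[c1 _].
have c0 : 0 < c by lra.
rewrite -subr_le0 E mulr_le0_ge0 ?subr_ge0//.
apply: le_trans (power_le c0) _; rewrite oppr_le0 mulr_ge0//.
  by rewrite divr_ge0// ltW.
apply: sumr_ge0 => k _; apply: sumr_ge0 => l _.
by rewrite mulr_ge0 ?weight_ge0 ?gap_ge0.
Qed.

Lemma speed_le (i : 'I_N) (t : R) : 1 <= t -> hnorm (v i t) <= speed.
Proof.
move=> t1; have t0 : 0 < t by lra.
rewrite /hnorm /speed ler_wsqrtr//; apply: le_trans (energy_le t1).
rewrite /energy (bigD1 i)//= lerDl; apply: sumr_ge0 => j _.
exact: tangent_ge0 (sol_on j t0) (sol_tangent j t0).
Qed.

Let speed_ge0 : 0 <= speed. Proof. exact: sqrtr_ge0. Qed.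

Let accel : R := kappa / N%:R * \sum_(j < N) (4 * M * speed).

(** The bound on (r coth r) phi(r) compensates the growth of the derivative of
the logarithm with the distance. *)
Lemma acc_le (i : 'I_N) (t : R) : 1 <= t -> hnorm (acc i t) <= accel.
Proof.
move=> t1; have t0 : 0 < t by lra.
have kN : 0 <= kappa / N%:R by rewrite divr_ge0// ltW.
rewrite sol_acc// hnormZ ger0_norm// /accel ler_wpM2l//.
have hi := sol_on i t0; have ti := sol_tangent i t0.
apply: le_trans (hnorm_sum hi _) _.
  move=> j; apply: tangentZ; apply: tangent_log_rate => //; exact: sol_on.
apply: ler_sum => j _; rewrite hnormZ ger0_norm ?weight_ge0//.
have hj := sol_on j t0; have tj := sol_tangent j t0.
apply: le_trans (ler_wpM2l (weight_ge0 i j t0) (hnorm_log_rate hi hj ti tj)) _.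
have := weight_ratio i j t0.
have g0 : 0 <= ucosh i j t * arcosh_ratio (ucosh i j t).
  by apply: le_trans ler01 _; apply: arcosh_ratioM_ge1; exact: lorentz_cosh_ge1.
have := speed_le i t1; have := speed_le j t1; have w0 := weight_ge0 i j t0.
move: (weight i j t) (ucosh i j t * _) w0 g0 => a b a0 b0 vj vi ab.
have ab0 : 0 <= a * b by rewrite mulr_ge0.
have -> : a * (2 * b * (hnorm (v i t) + hnorm (v j t))) =
  2 * (a * b) * (hnorm (v i t) + hnorm (v j t)) by ring.
apply: (@le_trans _ _ (2 * (a * b) * (speed + speed))).
  by rewrite ler_wpM2l ?lerD// mulr_ge0.
have := ler_wpM2r speed_ge0 ab; lra.
Qed.

Lemma gap_le (i j : 'I_N) (t : R) : 1 <= t -> gap i j t <= 4 * speed ^+ 2.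
Proof.
move=> t1; have t0 : 0 < t by lra.
have hi := sol_on i t0; have ti := sol_tangent i t0.
have hj := sol_on j t0; have tj := sol_tangent j t0.
have tT : tangent (x i t) (transport_formula (x i t) (x j t) (v j t)).
  exact: transport_tangent.
rewrite (discrepancyE hi hj ti tj).
have -> : 4 * speed ^+ 2 = (speed + speed) ^+ 2 by ring.
rewrite ler_sqr ?nnegrE ?hnorm_ge0 ?addr_ge0//.
apply: le_trans (hnormD hi tT (tangentN ti)) _.
by rewrite hnormN (hnorm_transport hi hj tj) lerD ?speed_le.
Qed.

Lemma gap_lipschitz (i j : 'I_N) (s t : R) : 1 <= s -> s <= t ->
  `|gap i j t - gap i j s| <= 8 * (accel * speed + speed ^+ 3) * (t - s).
Proof.
move=> s1 st.
have dgap (z : R) : 1 <= z -> is_derive z 1 (fun r => gap i j r)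
    (discrepancy_derivative (x i) (x j) z (v i z) (v j z) (vel' i z) (vel' j z)).
  move=> z1; have z0 : 0 < z by lra.
  by apply: is_derive_discrepancy; do ?[exact: near_sol_on|exact: sol_derive_x|
    exact: near_sol_tangent|exact: sol_derive_v].
have [c] : exists2 c, c \in `[s, t] & gap i j t - gap i j s =
    discrepancy_derivative (x i) (x j) c (v i c) (v j c) (vel' i c) (vel' j c)
      * (t - s).
  apply: (MVT_segment (f := fun r => gap i j r)) => // [z|].
    by rewrite in_itv/= => /andP[sz _]; apply: dgap; lra.
  apply: derivable_within_continuous => z; rewrite in_itv/= => /andP[sz _].
  by have [] := dgap z (le_trans s1 sz).
rewrite in_itv/= => /andP[sc _] ->.
have c1 : 1 <= c by lra.
have c0 : 0 < c by lra.
rewrite normrM [X in _ * X]ger0_norm ?subr_ge0// ler_wpM2r ?subr_ge0//.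
apply: (discrepancy_derivative_le (near_sol_on i c0) (near_sol_on j c0)
  (sol_derive_x i c0) (sol_derive_x j c0)); by [exact: speed_le|exact: acc_le].
Qed.

Lemma hdist_lipschitz (i j : 'I_N) (s t : R) : 1 <= s -> s <= t ->
  `|hdist (x i t) (x j t) - hdist (x i s) (x j s)| <= 2 * speed * (t - s).
Proof.
move=> s1 st; have s0 : 0 < s by lra. 
have t0 : 0 < t by lra.
rewrite !sol_hdist// mulrBr.
apply: (arcosh_le_primitive (u := fun r => ucosh i j r)
  (u' := fun r => - (lorentz (x j r) (v i r) + lorentz (x i r) (v j r)))
  (G := fun r => 2 * speed * r) (g := fun=> 2 * speed)) => //.
- apply: derivable_within_continuous => z; rewrite in_itv/= => /andP[sz _].
  have z0 : 0 < z by lra.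
  by have [] := is_derive_pairing (sol_derive_x i z0) (sol_derive_x j z0).
- apply: continuous_subspaceT => z; apply: cvgM; first exact: cvg_cst.
  exact: cvg_id.
- move=> z; rewrite in_itv/= => /andP[sz _].
  by apply: lorentz_cosh_ge1; apply: sol_on; lra.
- move=> z; rewrite in_itv/= => /andP[sz _].
  by apply: is_derive_pairing; apply: sol_derive_x; lra.
- move=> z _; apply: is_derive_eq (is_deriveZ (2 * speed) (is_derive_id z 1)) _.
  exact: mulr1.
move=> z; rewrite in_itv/= => /andP[sz _].
have z0 : 0 < z by lra.
have z1 : 1 <= z by lra.
split; first by rewrite mulr_ge0.
have hi := sol_on i z0; have hj := sol_on j z0.
have := tangent_pairing hi hj (sol_tangent i z0).
have := tangent_pairing hj hi (sol_tangent j z0).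
rewrite normrN sqrrN (lorentzC (x j z) (x i z)).
have := speed_le i z1; have := speed_le j z1.
have := sqrtr_ge0 (lorentz (x i z) (x j z) ^+ 2 - 1).
have := ler_normD (lorentz (x j z) (v i z)) (lorentz (x i z) (v j z)).
move: (Num.sqrt _) (`|_ + _|) (`|_|) (`|_|) => S a b c; nra.
Qed.

Lemma weighted_gap_cvg0 (i j : 'I_N) :
  (fun t => weight i j t * gap i j t) @ +oo --> (0 : R).
Proof.
have M0 : 0 <= M := le_trans (weight_ge0 i j ltr01) (weight_le i j ltr01).
have N0 : 0 < (N%:R : R) by rewrite ltr0n; case: N i => [[]|].
have accel0 : 0 <= accel.
  by apply: le_trans (hnorm_ge0 _) (acc_le i (lexx 1)).
apply: (@lipschitz_dissipation_cvg0 _ energy power _ (kappa / N%:R)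
  (M * (8 * (accel * speed + speed ^+ 3)) +
   Lip * (2 * speed) * (4 * speed ^+ 2))).
- by rewrite divr_gt0.
- have X0 : 0 <= accel * speed + speed ^+ 3.
    by apply: addr_ge0; [exact: mulr_ge0|exact: exprn_ge0].
  apply: addr_ge0; first by apply: mulr_ge0 => //; exact: mulr_ge0.
  by rewrite !mulr_ge0 ?exprn_ge0.
- by move=> t t1; apply: energy_ge0; lra.
- by move=> t t1; rewrite mulr_ge0 ?weight_ge0 ?gap_ge0//; lra.
- by move=> t t1; apply: energy_derive; lra.
- by move=> t t1; apply: power_le_pair; lra.
move=> s t s1 st; have t1 : 1 <= t by lra.
have s0 : 0 < s by lra.
have t0 : 0 < t by lra.
have -> : weight i j t * gap i j t - weight i j s * gap i j s =
  weight i j t * (gap i j t - gap i j s) +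
  (weight i j t - weight i j s) * gap i j s by ring.
apply: le_trans (ler_normD _ _) _; rewrite [X in _ <= X]mulrDl; apply: lerD.
  rewrite normrM ger0_norm ?weight_ge0// -mulrA.
  by apply: ler_pM => //; [exact: weight_ge0|exact: weight_le|exact: gap_lipschitz].
rewrite normrM (ger0_norm (gap_ge0 i j s0)).
have -> : Lip * (2 * speed) * (4 * speed ^+ 2) * (t - s) =
  Lip * (2 * speed * (t - s)) * (4 * speed ^+ 2) by ring.
apply: ler_pM => //; [exact: gap_ge0| |exact: gap_le].
apply: le_trans (phi_lip (sol_hdist_ge0 i j t0) (sol_hdist_ge0 i j s0)) _.
by rewrite ler_wpM2l// hdist_lipschitz.
Qed.

(** By phi <= M, the square of the left-hand side is at most M times the
weighted gap. *)
Lemma weighted_norm_cvg0 (i j : 'I_N) :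
  (fun t => phi (hdist (x i t) (x j t)) *
     hnorm (transport (x i t) (x j t) (v j t) - v i t)) @ +oo --> (0 : R).
Proof.
have cM : (fun t => Num.sqrt (M * (weight i j t * gap i j t))) @ +oo --> (0 : R).
  rewrite -[X in _ --> X](@sqrtr0 R); apply: continuous_cvg.
    exact: sqrt_continuous.
  rewrite -[X in _ --> X](mulr0 M); apply: cvgM; first exact: cvg_cst.
  exact: weighted_gap_cvg0.
apply: (squeeze_cvgr _ (@cvg_cst R^o 0 _ _ _) cM); near=> t.
have t1 : 1 <= t by near: t; apply: nbhs_pinfty_ge; exact: num_real.
have t0 : 0 < t by lra.
have hi := sol_on i t0; have ti := sol_tangent i t0.
have hj := sol_on j t0; have tj := sol_tangent j t0.
rewrite mulr_ge0 ?weight_ge0 ?hnorm_ge0//= (transportE hi hj tj).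
rewrite (discrepancyE hi hj ti tj).
move: (hnorm _) (hnorm_ge0 (transport_formula (x i t) (x j t) (v j t) - v i t)).
have := weight_ge0 i j t0; have := weight_le i j t0.
move: (weight i j t) => a aM a0 k k0.
rewrite -[X in X <= _]ger0_norm ?mulr_ge0// -sqrtr_sqr ler_wsqrtr//.
by rewrite exprMn mulrA ler_wpM2r ?sqr_ge0// expr2 ler_wpM2r.
Unshelve. all: by end_near. Qed.

End Solution.

Theorem theorem3p2 (R : realType) (d N : nat) (kappa : R) (phi : R -> R)
    (x0 v0 : 'I_N -> 'rV[R]_d.+1) (x v : 'I_N -> R -> 'rV[R]_d.+1)
    (kappa_gt0 : 0 < kappa)
    (phi_ge0 : forall r : R, 0 <= r -> 0 <= phi r)
    (phi_lip : [lipschitz phi r | r in `[0, +oo[])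
    (phi_sup : (ereal_sup [set (rcoth r * phi r)%:E | r in `[0%R, +oo[] < +oo)%E)
    (sol : is_global_solution kappa phi x0 v0 x v) :
  (fun t : R => \big[Num.max/0]_(i < N) \big[Num.max/0]_(j < N)
     (phi (hdist (x i t) (x j t)) *
      hnorm (transport (x i t) (x j t) (v j t) - v i t))) @ +oo --> (0 : R).
Proof.
have [L L0 HL] : exists2 L, 0 <= L & forall a b : R, 0 <= a -> 0 <= b ->
    `|phi a - phi b| <= L * `|a - b|.
  have [A [_ HA]] := phi_lip.
  pose L := Num.max 0 (A + 1).
  exists L; first by rewrite le_max lexx.
  move=> a b a0 b0.
  have AL : A < L by rewrite lt_max ltrDl ltr01 orbT.
  by apply: (HA L AL (a, b)); split; rewrite /= in_itv/= andbT.
have [M HM] : exists M, forall r, 0 <= r -> rcoth r * phi r <= M.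
  set S := [set (rcoth r * phi r)%:E | r in `[0%R, +oo[] in phi_sup.
  exists (fine (ereal_sup S)) => r r0.
  have rS : ((rcoth r * phi r)%:E <= ereal_sup S)%E.
    by apply: ereal_sup_ubound; exists r => //=; rewrite in_itv/= andbT.
  rewrite -lee_fin fineK//.
  by rewrite fin_numElt phi_sup andbT (lt_le_trans _ rS)// ltNyr.
apply/cvgrPdist_le => e e0.
have H (i j : 'I_N) : \forall t \near +oo, phi (hdist (x i t) (x j t)) *
    hnorm (transport (x i t) (x j t) (v j t) - v i t) <= e.
  have := weighted_norm_cvg0 kappa_gt0 phi_ge0 L0 HL HM sol i j.
  move=> /cvgrPdist_le /(_ e e0); apply: filterS => t.
  by rewrite sub0r normrN; apply: le_trans; exact: ler_norm.
have {}H : \forall t \near +oo, forall i j : 'I_N, phi (hdist (x i t) (x j t)) *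
    hnorm (transport (x i t) (x j t) (v j t) - v i t) <= e.
  by apply: filter_forall => i; apply: filter_forall => j; exact: H.
apply: filterS H => t H; rewrite sub0r normrN ger0_norm.
  apply: bigmax_le => [|i _]; first exact: ltW.
  by apply: bigmax_le => [|j _]; [exact: ltW|exact: H].
exact: bigmax_ge_id.
Qed.
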